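(* Assume that $P\in\mathbb R$, $S>0$, $k>0$ and $g=0$. For any integer $m\ge1$ there exists $\overline\alpha_m<0$ such that for all $\alpha<\overline\alpha_m$ the following assertions hold: (i) There exists a unimodal solution $U_{m,\alpha}(x,y)=\psi(y)\sin(mx)$ of the stationary problem (ST), having $m-1$ zeros in the $x$-direction. (ii) There exist at least $m$ unimodal solutions $U_{1,\alpha},\dots,U_{m,\alpha}$ of (ST); these solutions have from $0$ up to $m-1$ zeros in the $x$-direction (i.e. $U_{j,\alpha}(x,y)=\psi_j(y)\sin(jx)$, $j=1,\dots,m$). (iii) There exist infinitely many unimodal solutions $V_{m,\alpha}$ of the evolution problem (PL), of the form $V_{m,\alpha}(x,y,t)=\phi(t)U_{m,\alpha}(x,y)$, and, as $t\to\infty$, either $V_{m,\alpha}(t)\to0$, or $V_{m,\alpha}(t)\to U_{m,\alpha}$, or $V_{m,\alpha}(t)\to-U_{m,\alpha}$. The initial data in (PL) may be chosen in such a way that $V_{m,\alpha}(t)$ attains any of these limits.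
   Context: Let $\ell>0$, $\Omega=(0,\pi)\times(-\ell,\ell)$ with coordinates $(x,y)$, and $\sigma\in(0,1)$; $\|\cdot\|_0$ is the $L^2(\Omega)$ norm. Boundary conditions (BC): $u=u_{xx}=0$ on $\{0,\pi\}\times[-\ell,\ell]$; $u_{yy}+\sigma u_{xx}=u_{yyy}+(2-\sigma)u_{xxy}=0$ on $[0,\pi]\times\{-\ell,\ell\}$. Evolution problem (PL) with $g=0$: $u_{tt}+ku_t+\Delta^2u+[P-S\int_\Omega u_x^2]u_{xx}=\alpha u_y$ in $\Omega\times(0,\infty)$ with (BC) and initial data $u(0)=u_0$, $u_t(0)=v_0$. Stationary problem (ST) with $g=0$: $\Delta^2u-S\|u_x\|_0^2u_{xx}+Pu_{xx}-\alpha u_y=0$ in $\Omega$ with (BC). A unimodal solution of (ST) is a solution of the form $\psi(y)\sin(mx)$ with $m\ge 1$ an integer and $\psi\not\equiv0$; a unimodal solution of (PL) is a solution of the form $\phi(t)\psi(y)\sin(mx)$ with $\phi,\psi\not\equiv0$. Such functions are said to have $m-1$ zeros in the $x$-direction. Convergence of $V_{m,\alpha}(t)=\phi(t)U_{m,\alpha}$ is understood in $H^2(\Omega)$ (equivalently, convergence of the scalar $\phi(t)$ to $0$, $1$, $-1$ respectively). *)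

(* Defs.v *)
From Stdlib Require Import Reals List.
From Coquelicot Require Import Coquelicot.
Open Scope R_scope.

(** The plate is [Omega = (0, PI) x (-l, l)].  Functions on (the closure of)
    [Omega] are represented by functions on the whole of R^2 and functions on
    [[0, oo) x closure Omega] by functions on R^3: "of class C^k up to the
    boundary" means being the restriction of a function which is C^k on the
    whole space, so that the values on the boundary of all derivatives involved
    depend on the restriction only.  The equations, the boundary conditions and
    the requirements on the shape of a solution are imposed on the physical
    domain only. *)

Definition Omega (l x y : R) : Prop := 0 < x < PI /\ - l < y < l.

Definition clOmega (l x y : R) : Prop := 0 <= x <= PI /\ - l <= y <= l.

(** [pd i j u] is the i-th derivative in x of the j-th derivative in y of [u]. *)
Notation pd := partial_derive.

Definition bilaplacian (u : R -> R -> R) (x y : R) : R :=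
  pd 4 0 u x y + 2 * pd 2 2 u x y + pd 0 4 u x y.

(** Only applied to functions that are continuous on the closure of [Omega],
    for which this is the Lebesgue integral over [Omega]. *)
Definition int_Omega (l : R) (f : R -> R -> R) : R :=
  RInt (fun x => RInt (fun y => f x y) (- l) l) 0 PI.

Definition norm_L2 (l : R) (f : R -> R -> R) : R :=
  sqrt (int_Omega l (fun x y => f x y ^ 2)).

Definition norm_H2 (l : R) (f : R -> R -> R) : R :=
  sqrt (norm_L2 l f ^ 2
        + norm_L2 l (pd 1 0 f) ^ 2 + norm_L2 l (pd 0 1 f) ^ 2
        + norm_L2 l (pd 2 0 f) ^ 2 + norm_L2 l (pd 1 1 f) ^ 2
        + norm_L2 l (pd 0 2 f) ^ 2).

Definition cvg_H2 (l : R) (V : R -> R -> R -> R) (L : R -> R -> R) : Prop :=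
  is_lim (fun t => norm_H2 l (fun x y => V t x y - L x y)) p_infty 0.

Definition BC (l sigma : R) (u : R -> R -> R) : Prop :=
  (forall x y, x = 0 \/ x = PI -> - l <= y <= l ->
     u x y = 0 /\ pd 2 0 u x y = 0) /\
  (forall x y, 0 <= x <= PI -> y = - l \/ y = l ->
     pd 0 2 u x y + sigma * pd 2 0 u x y = 0 /\
     pd 0 3 u x y + (2 - sigma) * pd 2 1 u x y = 0).

(** Partially hinged plate, no external load: [sigma] is the Poisson ratio, [P] the
    prestressing, [S] the stretching coefficient, [alpha] the wind velocity and
    [k] the damping. *)
Definition solves_ST (l sigma P S alpha : R) (u : R -> R -> R) : Prop :=
  (forall x y, ex_diff_n u 4 x y) /\
  BC l sigma u /\
  (forall x y, Omega l x y ->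
     bilaplacian u x y - S * norm_L2 l (pd 1 0 u) ^ 2 * pd 2 0 u x y
     + P * pd 2 0 u x y - alpha * pd 0 1 u x y = 0).

(** Functions of time and space are written [u t x y]; [dt n u] is the n-th
    time derivative. *)
Definition dt (n : nat) (u : R -> R -> R -> R) (t x y : R) : R :=
  Derive_n (fun s => u s x y) n t.

Definition jointly_continuous (u : R -> R -> R -> R) : Prop :=
  forall q : R * R * R,
    continuous (fun p : R * R * R => u (fst (fst p)) (snd (fst p)) (snd p)) q.

Definition regular_PL (u : R -> R -> R -> R) : Prop :=
  (forall n t x y, (n <= 2)%nat -> ex_derive_n (fun s => u s x y) n t) /\
  (forall n, (n <= 2)%nat -> jointly_continuous (dt n u)) /\
  (forall t x y, ex_diff_n (u t) 4 x y) /\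
  (forall i j, (i + j <= 4)%nat -> jointly_continuous (fun t => pd i j (u t))).

Definition solves_PL (l sigma P S alpha k : R) (u0 v0 : R -> R -> R)
    (u : R -> R -> R -> R) : Prop :=
  regular_PL u /\
  (forall t, 0 < t -> BC l sigma (u t)) /\
  (forall t x y, 0 < t -> Omega l x y ->
     dt 2 u t x y + k * dt 1 u t x y + bilaplacian (u t) x y
     + (P - S * int_Omega l (fun x' y' => pd 1 0 (u t) x' y' ^ 2))
       * pd 2 0 (u t) x y
     = alpha * pd 0 1 (u t) x y) /\
  (forall x y, Omega l x y -> u 0 x y = u0 x y /\ dt 1 u 0 x y = v0 x y).

Definition unimodal_ST (l sigma P S alpha : R) (m : nat) (u : R -> R -> R)
    : Prop :=
  (1 <= m)%nat /\ solves_ST l sigma P S alpha u /\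
  exists psi : R -> R,
    (exists y, - l < y < l /\ psi y <> 0) /\
    (forall x y, clOmega l x y -> u x y = psi y * sin (INR m * x)).

Definition unimodal_PL (l sigma P S alpha k : R) (m : nat)
    (u0 v0 : R -> R -> R) (u : R -> R -> R -> R) : Prop :=
  (1 <= m)%nat /\ solves_PL l sigma P S alpha k u0 v0 u /\
  exists phi psi : R -> R,
    (exists t, 0 <= t /\ phi t <> 0) /\
    (exists y, - l < y < l /\ psi y <> 0) /\
    (forall t x y, 0 <= t -> clOmega l x y ->
       u t x y = phi t * psi y * sin (INR m * x)).

(** [u] has exactly [n] zeros in the x-direction: there are exactly [n] points
    x in (0, PI) such that [u] vanishes on the line {x} x (-l, l).  For
    [psi y * sin (m x)], with [psi] not identically zero, [n] is [m - 1]. *)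
Definition zeros_in_x (l : R) (n : nat) (u : R -> R -> R) : Prop :=
  exists zs : list R, NoDup zs /\ length zs = n /\
    forall x, In x zs <-> (0 < x < PI /\ forall y, - l < y < l -> u x y = 0).

(* Main.v *)
Require Import Defs.
From Stdlib Require Import Reals List.
From Coquelicot Require Import Coquelicot.
From Stdlib Require Import ZArith Lra Lia Psatz.
From Stdlib Require Import FunctionalExtensionality Classical FinFun Ranalysis5.
Open Scope R_scope.

(** For [u = psi(y) sin(m x)] and [beta = - alpha] the stationary problem reads
    [psi'''' - 2 m^2 psi'' + beta psi' + kappa psi = 0] with
    [kappa = m^4 + m^2 (S ||u_x||^2 - P)], so that, after rescaling, one only needs an
    eigenfunction with [kappa] large.  For large [beta] two characteristic roots are
    [c +- i d] with [c] of order [beta^(1/3)] and [d] about [sqrt 3 c], one is about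
    [- 2 c], and one, [a], stays of order one when [kappa] is of order [beta].  Up to
    errors of order [exp (- 2 c l)] the solvability determinant of the four boundary
    conditions factors into the contributions of the two edges, and changes sign where
    [a^2 = sigma m^2]; the intermediate value theorem along [beta = const] between
    [a = - sigma m] and [a = - m] gives the eigenfunction, and there [kappa] tends to
    infinity with [c].

    Multiplying a stationary solution by [phi(t)] reduces the evolution problem to the
    damped Duffing equation [phi'' + k phi' + w (phi^3 - phi) = 0]: bounded solutions
    converge to [0], [1] or [-1] by the decay of the energy, and nontrivial solutions
    converging to [0] are power series in [exp (- nu t)]. *)

(** * Separated eigenfunctions of the plate *)

Definition mode (l a b c d A B C D y : R) : R :=
  A * exp (a * (y + l)) + B * exp (b * (y + l))
  + exp (c * (y - l)) * (C * cos (d * (y - l)) + D * sin (d * (y - l))).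

Lemma is_derive_mode (l a b c d A B C D y : R) :
  is_derive (mode l a b c d A B C D) y
    (mode l a b c d (a * A) (b * B) (c * C + d * D) (c * D - d * C) y).
Proof. unfold mode; auto_derive; [easy | unfold Rminus; ring]. Qed.

Lemma Derive_mode (l a b c d A B C D : R) :
  Derive (mode l a b c d A B C D) =
  mode l a b c d (a * A) (b * B) (c * C + d * D) (c * D - d * C).
Proof.
  apply functional_extensionality; intros y.
  apply is_derive_unique, is_derive_mode.
Qed.

Definition smooth (f : R -> R) : Prop := forall n x, ex_derive_n f n x.

Lemma Derive_n_S_Derive (f : R -> R) (n : nat) :
  Derive_n f (S n) = Derive_n (Derive f) n.
Proof.
  induction n as [|n IH]; [easy|].
  change (Derive (Derive_n f (S n)) = Derive_n (Derive f) (S n)).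
  now rewrite IH.
Qed.

Lemma ex_derive_n_S_Derive (f : R -> R) (n : nat) (x : R) :
  (forall y, ex_derive f y) -> ex_derive_n (Derive f) n x -> ex_derive_n f (S n) x.
Proof.
  intros Hf H; destruct n as [|n]; [apply Hf|].
  change (ex_derive (Derive_n f (S n)) x); rewrite Derive_n_S_Derive; exact H.
Qed.

Lemma smooth_mode (l a b c d A B C D : R) : smooth (mode l a b c d A B C D).
Proof.
  intros n; revert A B C D; induction n as [|n IH]; intros A B C D x; [easy|].
  apply ex_derive_n_S_Derive.
  - intros y; eexists; apply is_derive_mode.
  - rewrite Derive_mode; apply IH.
Qed.

Lemma mode_plus (l a b c d A B C D A' B' C' D' y : R) :
  mode l a b c d A B C D y + mode l a b c d A' B' C' D' y =
  mode l a b c d (A + A') (B + B') (C + C') (D + D') y.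
Proof. unfold mode; ring. Qed.

Lemma mode_scal (l a b c d A B C D k y : R) :
  k * mode l a b c d A B C D y = mode l a b c d (k * A) (k * B) (k * C) (k * D) y.
Proof. unfold mode; ring. Qed.

Lemma mode_0 (l a b c d y : R) : mode l a b c d 0 0 0 0 y = 0.
Proof. unfold mode; ring. Qed.

(** The characteristic polynomial [r^4 - 2 m^2 r^2 + beta r + kappa] in terms of its
    roots [a] and [c +- i d]: the fourth root, [d^2], [beta] and [kappa]. *)
Definition root4 (a c : R) : R := - 2 * c - a.
Definition imsq (m a c : R) : R := 3 * c ^ 2 + 2 * a * c + a ^ 2 - 2 * m ^ 2.
Definition drift (m a c : R) : R := 4 * c * (2 * c ^ 2 + 2 * a * c + a ^ 2 - m ^ 2).
Definition level (m a c : R) : R := a * root4 a c * (c ^ 2 + imsq m a c).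

Lemma mode_ode (l m a c d A B C D y : R) :
  d ^ 2 = imsq m a c ->
  let psi := mode l a (root4 a c) c d A B C D in
  Derive_n psi 4 y - 2 * m ^ 2 * Derive_n psi 2 y + drift m a c * Derive psi y
  + level m a c * psi y = 0.
Proof.
  intros Hd psi; unfold psi; simpl Derive_n; rewrite !Derive_mode.
  replace (drift m a c * _) with (- (- drift m a c) *
    mode l a (root4 a c) c d (a * A) (root4 a c * B) (c * C + d * D) (c * D - d * C) y) by ring.
  unfold Rminus; rewrite !Ropp_mult_distr_l, !mode_scal, !mode_plus.
  rewrite <- (mode_0 l a (root4 a c) c d y).
  unfold imsq in Hd.
  f_equal; unfold level, drift, root4, imsq.
  - ring.
  - ring.
  - assert (H3 : d * d * d = d * (d ^ 2)) by ring.
    assert (Hm : 2 * m ^ 2 = 3 * c ^ 2 + 2 * a * c + a ^ 2 - d ^ 2) by lra.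
    assert (Hm' : m ^ 2 = (3 * c ^ 2 + 2 * a * c + a ^ 2 - d ^ 2) / 2) by lra.
    rewrite Hm'; field.
  - assert (Hm' : m ^ 2 = (3 * c ^ 2 + 2 * a * c + a ^ 2 - d ^ 2) / 2) by lra.
    rewrite Hm'; field.
Qed.

Lemma mode_neq0 (l a b c d A B C D : R) :
  0 < l -> a <> b -> d <> 0 -> A <> 0 \/ B <> 0 ->
  exists y, - l < y < l /\ mode l a b c d A B C D y <> 0.
Proof.
  intros Hl Hab Hd HAB; apply NNPP; intros H.
  assert (H0 : forall n, Derive_n (mode l a b c d A B C D) n 0 = 0).
  { intros n; rewrite (Derive_n_ext_loc _ (fun _ => 0)).
    - destruct n as [|n]; [easy | apply Derive_n_const].
    - exists (mkposreal l Hl); intros y Hy; apply NNPP; intros Hne.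
      apply H; exists y; split; [|easy].
      change (Rabs (y - 0) < l) in Hy; apply Rabs_def2 in Hy; lra. }
  assert (E0 := H0 0%nat); assert (E1 := H0 1%nat).
  assert (E2 := H0 2%nat); assert (E3 := H0 3%nat).
  simpl in E0, E1, E2, E3.
  rewrite !Derive_mode in E1; rewrite !Derive_mode in E2; rewrite !Derive_mode in E3.
  match type of E0 with ?e0 = _ => match type of E1 with ?e1 = _ =>
  match type of E2 with ?e2 = _ => match type of E3 with ?e3 = _ =>
    assert (Hcomb : forall r, e3 - (r + 2 * c) * e2 + (2 * r * c + c ^ 2 + d ^ 2) * e1
                              - r * (c ^ 2 + d ^ 2) * e0 = 0)
      by (intros r; rewrite E0, E1, E2, E3; ring)
  end end end end.
  set (X := A * exp (a * (0 + l))).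
  set (Y := B * exp (b * (0 + l))).
  assert (HX : (a - b) * ((a - c) ^ 2 + d ^ 2) * X = 0).
  { unfold X.
    etransitivity; [|apply (Hcomb b)]; unfold mode; ring. }
  assert (HY : (b - a) * ((b - c) ^ 2 + d ^ 2) * Y = 0).
  { unfold Y.
    etransitivity; [|apply (Hcomb a)]; unfold mode; ring. }
  assert (Hs : forall r, (r - c) ^ 2 + d ^ 2 <> 0).
  { intros r; assert (H1 := pow2_gt_0 _ Hd); assert (H2 := pow2_ge_0 (r - c)); lra. }
  assert (He := exp_pos (a * (0 + l))); assert (He' := exp_pos (b * (0 + l))).
  assert (A = 0 /\ B = 0); [|intuition].
  split.
  - apply Rmult_integral in HX as [HX|HX]; [|unfold X in HX; apply Rmult_integral in HX; lra].
    apply Rmult_integral in HX as [HX|HX]; [lra | now apply Hs in HX].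
  - apply Rmult_integral in HY as [HY|HY]; [|unfold Y in HY; apply Rmult_integral in HY; lra].
    apply Rmult_integral in HY as [HY|HY]; [lra | now apply Hs in HY].
Qed.

(** The boundary operators [psi'' - s1 psi] and [psi''' - s2 psi'] act on
    [exp (r y)] by the real symbols [symE], [symF], and on [exp ((c + i d) y)]
    by the complex symbols with the real and imaginary parts below. *)
Definition symE (s1 r : R) : R := r ^ 2 - s1.
Definition symF (s2 r : R) : R := r * (r ^ 2 - s2).
Definition reE (s1 c d : R) : R := c ^ 2 - d ^ 2 - s1.
Definition imE (c d : R) : R := 2 * c * d.
Definition reF (s2 c d : R) : R := c * (c ^ 2 - 3 * d ^ 2 - s2).
Definition imF (s2 c d : R) : R := d * (3 * c ^ 2 - d ^ 2 - s2).

Lemma modeE (l a b c d A B C D s1 y : R) :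
  let psi := mode l a b c d A B C D in
  Derive_n psi 2 y - s1 * psi y =
  mode l a b c d (symE s1 a * A) (symE s1 b * B)
    (reE s1 c d * C + imE c d * D) (reE s1 c d * D - imE c d * C) y.
Proof.
  intros psi; unfold psi; simpl Derive_n; rewrite !Derive_mode.
  unfold mode, symE, reE, imE; ring.
Qed.

Lemma modeF (l a b c d A B C D s2 y : R) :
  let psi := mode l a b c d A B C D in
  Derive_n psi 3 y - s2 * Derive psi y =
  mode l a b c d (symF s2 a * A) (symF s2 b * B)
    (reF s2 c d * C + imF s2 c d * D) (reF s2 c d * D - imF s2 c d * C) y.
Proof.
  intros psi; unfold psi; simpl Derive_n; rewrite !Derive_mode.
  unfold mode, symF, reF, imF; ring.
Qed.

(** Cramer's rule for the oscillating part of
    [exp (r (y + l)) + exp (2 r l) exp (c (y - l)) (C cos + D sin)]: with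
    [C = cofC / minor] and [D = cofD / minor] this function satisfies both
    boundary conditions at [y = l]; [resE] and [resF] are ([minor] times) its
    boundary values at [y = - l]. *)
Definition minor (s1 s2 c d : R) : R := reE s1 c d * imF s2 c d - imE c d * reF s2 c d.
Definition cofC (s1 s2 c d r : R) : R := symF s2 r * imE c d - symE s1 r * imF s2 c d.
Definition cofD (s1 s2 c d r : R) : R := symE s1 r * reF s2 c d - symF s2 r * reE s1 c d.

Definition tailE (l s1 s2 c d r : R) : R :=
  cofC s1 s2 c d r * (reE s1 c d * cos (2 * d * l) + imE c d * sin (2 * d * l))
  + cofD s1 s2 c d r * (imE c d * cos (2 * d * l) - reE s1 c d * sin (2 * d * l)).
Definition tailF (l s1 s2 c d r : R) : R :=
  cofC s1 s2 c d r * (reF s2 c d * cos (2 * d * l) + imF s2 c d * sin (2 * d * l))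
  + cofD s1 s2 c d r * (imF s2 c d * cos (2 * d * l) - reF s2 c d * sin (2 * d * l)).

Definition resE (l s1 s2 c d r : R) : R :=
  minor s1 s2 c d * symE s1 r + exp (2 * (r - c) * l) * tailE l s1 s2 c d r.
Definition resF (l s1 s2 c d r : R) : R :=
  minor s1 s2 c d * symF s2 r + exp (2 * (r - c) * l) * tailF l s1 s2 c d r.

Definition bc_det (l s1 s2 a b c d : R) : R :=
  resE l s1 s2 c d a * resF l s1 s2 c d b - resE l s1 s2 c d b * resF l s1 s2 c d a.

Lemma kernel_2x2 (x y z w : R) :
  x * w - y * z = 0 ->
  exists A B, (A <> 0 \/ B <> 0) /\ A * x + B * y = 0 /\ A * z + B * w = 0.
Proof.
  intros H.
  destruct (Req_dec x 0) as [Hx|Hx]; [destruct (Req_dec y 0) as [Hy|Hy];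
    [destruct (Req_dec z 0) as [Hz|Hz]|]|].
  - exists 1, 0; subst; repeat split; [left|..]; lra.
  - exists (- w), z; subst; repeat split; [now right|..]; ring.
  - exists y, (- x); repeat split; [now left|..]; lra.
  - exists y, (- x); repeat split; [right|..]; lra.
Qed.

Lemma mode_bc (l s1 s2 a b c d : R) :
  0 < l -> a <> b -> d <> 0 -> minor s1 s2 c d <> 0 ->
  bc_det l s1 s2 a b c d = 0 ->
  exists A B C D, let psi := mode l a b c d A B C D in
    (forall y, y = - l \/ y = l ->
       Derive_n psi 2 y - s1 * psi y = 0 /\
       Derive_n psi 3 y - s2 * Derive psi y = 0) /\
    exists y, - l < y < l /\ psi y <> 0.
Proof.
  intros Hl Hab Hd HM H.
  destruct (kernel_2x2 _ _ _ _ H) as [A [B [HAB [HE HF]]]].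
  set (M := minor s1 s2 c d) in *.
  exists (M * A), (M * B),
    (A * exp (2 * a * l) * cofC s1 s2 c d a + B * exp (2 * b * l) * cofC s1 s2 c d b),
    (A * exp (2 * a * l) * cofD s1 s2 c d a + B * exp (2 * b * l) * cofD s1 s2 c d b).
  intros psi; split.
  - unfold resE, resF in HE, HF; fold M in HE, HF.
    assert (Hexp : forall r, exp (2 * (r - c) * l) = exp (2 * r * l) * exp (- (2 * c * l))).
    { intros r; rewrite <- exp_plus; f_equal; ring. }
    rewrite !Hexp in HE, HF.
    intros y [->| ->]; unfold psi; rewrite modeE, modeF; unfold mode.
    + replace (- l + l) with 0 by ring.
      replace (c * (- l - l)) with (- (2 * c * l)) by ring.
      replace (d * (- l - l)) with (- (2 * d * l)) by ring.
      rewrite cos_neg, sin_neg, !Rmult_0_r, exp_0.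
      split; [rewrite <- HE | rewrite <- HF]; unfold tailE, tailF; ring.
    + replace (l - l) with 0 by ring.
      replace (a * (l + l)) with (2 * a * l) by ring.
      replace (b * (l + l)) with (2 * b * l) by ring.
      rewrite !Rmult_0_r, exp_0, cos_0, sin_0.
      unfold M, minor, cofC, cofD; split; ring.
  - apply mode_neq0; try assumption.
    destruct HAB as [HA|HB]; [left|right]; now apply Rmult_integral_contrapositive_currified.
Qed.

Lemma pow_exp_small (K delta eps : R) (n : nat) :
  0 <= K -> 0 < delta -> 0 < eps ->
  exists C0, 0 < C0 /\ forall c, C0 <= c -> K * c ^ n * exp (- (delta * c)) < eps.
Proof.
  intros HK Hd He.
  set (q := delta / INR (S n)).
  assert (HN : 0 < INR (S n)) by (apply lt_0_INR; lia).
  assert (Hq : 0 < q) by (apply Rdiv_lt_0_compat; lra).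
  assert (Hqn : 0 < q ^ S n) by (apply pow_lt; lra).
  exists (K / (q ^ S n * eps) + 1).
  assert (H0 : 0 <= K / (q ^ S n * eps))
    by (apply Rdiv_le_0_compat; [lra | apply Rmult_lt_0_compat; lra]).
  split; [lra|]; intros c Hc.
  assert (Hc0 : 0 < c) by lra.
  assert (Hcn : 0 < c ^ n) by (apply pow_lt; lra).
  assert (Hexp : q ^ S n * c ^ S n <= exp (delta * c)).
  { replace (delta * c) with (INR (S n) * (q * c)) by (unfold q; field; lra).
    rewrite <- Rpow_mult_distr.
    assert (Hpow : exp (INR (S n) * (q * c)) = exp (q * c) ^ S n).
    { generalize (S n) as j; induction j as [|j IH].
      - simpl; rewrite Rmult_0_l; apply exp_0.
      - rewrite S_INR, Rmult_plus_distr_r, exp_plus, IH, Rmult_1_l; simpl; ring. }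
    rewrite Hpow; apply pow_incr.
    assert (H1 := exp_ineq1_le (q * c)).
    assert (0 < q * c) by (apply Rmult_lt_0_compat; lra); lra. }
  rewrite exp_Ropp.
  assert (HE := exp_pos (delta * c)).
  apply Rmult_lt_reg_r with (exp (delta * c)); [easy|].
  rewrite Rmult_assoc, Rinv_l, Rmult_1_r by lra.
  apply Rlt_le_trans with (eps * (q ^ S n * c ^ S n)); [|apply Rmult_le_compat_l; lra].
  assert (HK' : K < q ^ S n * eps * c).
  { apply Rmult_lt_reg_r with (/ (q ^ S n * eps)).
    - apply Rinv_0_lt_compat, Rmult_lt_0_compat; lra.
    - replace (q ^ S n * eps * c * / (q ^ S n * eps)) with c by (field; lra).
      unfold Rdiv in Hc; lra. }
  replace (eps * (q ^ S n * c ^ S n)) with (q ^ S n * eps * c * c ^ n) by (simpl; ring).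
  apply Rmult_lt_compat_r; lra.
Qed.

Lemma Rabs_mult_le (x y X Y : R) : Rabs x <= X -> Rabs y <= Y -> Rabs (x * y) <= X * Y.
Proof.
  intros Hx Hy; rewrite Rabs_mult.
  apply Rmult_le_compat; try apply Rabs_pos; assumption.
Qed.

Lemma Rabs_plus_le (x y X Y : R) : Rabs x <= X -> Rabs y <= Y -> Rabs (x + y) <= X + Y.
Proof. intros; eapply Rle_trans; [apply Rabs_triang | lra]. Qed.

Lemma Rabs_minus_le (x y X Y : R) : Rabs x <= X -> Rabs y <= Y -> Rabs (x - y) <= X + Y.
Proof. intros; unfold Rminus; apply Rabs_plus_le; [|rewrite Rabs_Ropp]; assumption. Qed.

Lemma cross_terms_bound (M E F x y t u T eta : R) :
  Rabs M <= 2 * T ^ 2 -> Rabs E <= T -> Rabs F <= T -> Rabs t <= 8 * T ^ 3 ->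
  Rabs u <= 8 * T ^ 3 -> 0 <= x <= eta -> 0 <= y <= eta -> eta <= 1 -> 0 <= T ->
  Rabs ((M * E + x * t) * (M * F + y * u) - M * E * (M * F)) <= 96 * T ^ 6 * eta.
Proof.
  intros HM HE HF Ht Hu Hx Hy He HT.
  replace ((M * E + x * t) * (M * F + y * u) - M * E * (M * F))
    with (M * E * (y * u) + x * t * (M * F) + x * t * (y * u)) by ring.
  apply Rle_trans with
    (2 * T ^ 2 * T * (eta * (8 * T ^ 3)) + eta * (8 * T ^ 3) * (2 * T ^ 2 * T)
     + eta * (8 * T ^ 3) * (1 * (8 * T ^ 3))); [|right; ring].
  assert (Rabs x <= eta) by (rewrite Rabs_pos_eq; lra).
  assert (Rabs y <= eta) by (rewrite Rabs_pos_eq; lra).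
  assert (Rabs y <= 1) by lra.
  repeat first [assumption | apply Rabs_plus_le | apply Rabs_mult_le].
Qed.

Lemma bc_det_bound (l s1 s2 a b c d T eta : R) :
  0 <= T -> eta <= 1 ->
  exp (2 * (a - c) * l) <= eta -> exp (2 * (b - c) * l) <= eta ->
  Rabs (symE s1 a) <= T -> Rabs (symE s1 b) <= T ->
  Rabs (symF s2 a) <= T -> Rabs (symF s2 b) <= T ->
  Rabs (reE s1 c d) <= T -> Rabs (imE c d) <= T ->
  Rabs (reF s2 c d) <= T -> Rabs (imF s2 c d) <= T ->
  Rabs (bc_det l s1 s2 a b c d
        - minor s1 s2 c d ^ 2 * (symE s1 a * symF s2 b - symE s1 b * symF s2 a))
  <= 192 * T ^ 6 * eta.
Proof.
  intros HT He Hxa Hxb HEa HEb HFa HFb H1 H2 H3 H4.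
  assert (HM : Rabs (minor s1 s2 c d) <= 2 * T ^ 2).
  { replace (2 * T ^ 2) with (T * T + T * T) by ring.
    apply Rabs_minus_le; now apply Rabs_mult_le. }
  assert (Hcos : Rabs (cos (2 * d * l)) <= 1) by (apply Rabs_le, COS_bound).
  assert (Hsin : Rabs (sin (2 * d * l)) <= 1) by (apply Rabs_le, SIN_bound).
  assert (Htail : forall r, Rabs (symE s1 r) <= T -> Rabs (symF s2 r) <= T ->
            Rabs (tailE l s1 s2 c d r) <= 8 * T ^ 3 /\
            Rabs (tailF l s1 s2 c d r) <= 8 * T ^ 3).
  { intros r HE HF.
    replace (8 * T ^ 3) with ((T * T + T * T) * (T * 1 + T * 1)
      + (T * T + T * T) * (T * 1 + T * 1)) by ring.
    unfold tailE, tailF, cofC, cofD; split;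
      repeat first [assumption | apply Rabs_minus_le | apply Rabs_plus_le
                   | apply Rabs_mult_le]. }
  destruct (Htail a) as [HtEa HtFa]; try assumption.
  destruct (Htail b) as [HtEb HtFb]; try assumption.
  assert (Ha := exp_pos (2 * (a - c) * l)); assert (Hb := exp_pos (2 * (b - c) * l)).
  unfold bc_det, resE, resF.
  match goal with |- Rabs (?p - ?q - ?r) <= _ =>
    replace (p - q - r) with
      ((p - minor s1 s2 c d * symE s1 a * (minor s1 s2 c d * symF s2 b))
       - (q - minor s1 s2 c d * symE s1 b * (minor s1 s2 c d * symF s2 a))) by ring
  end.
  replace (192 * T ^ 6 * eta) with (96 * T ^ 6 * eta + 96 * T ^ 6 * eta) by ring.
  apply Rabs_minus_le; apply cross_terms_bound; try assumption; lra.
Qed.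

Lemma imsq_bounds (m a c : R) :
  0 < m -> - m <= a <= 0 -> 10 * m <= c -> c ^ 2 <= imsq m a c <= 3 * c ^ 2.
Proof. intros; unfold imsq; split; nra. Qed.

Lemma imag_part_bounds (m a c : R) :
  0 < m -> - m <= a <= 0 -> 10 * m <= c ->
  let d := sqrt (imsq m a c) in d ^ 2 = imsq m a c /\ c <= d <= 2 * c.
Proof.
  intros Hm Ha Hc d; destruct (imsq_bounds m a c) as [H1 H2]; try assumption.
  assert (Hd : d ^ 2 = imsq m a c) by (apply pow2_sqrt; nra).
  assert (0 <= d) by apply sqrt_pos.
  repeat split; [assumption | nra | nra].
Qed.

Lemma minor_ge1 (sigma m c d : R) :
  0 < sigma < 1 -> 0 < m -> 10 * m <= c -> 1 <= c -> c <= d <= 2 * c ->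
  1 <= minor (sigma * m ^ 2) ((2 - sigma) * m ^ 2) c d.
Proof.
  intros Hs Hm Hc Hc1 Hd.
  set (s1 := sigma * m ^ 2); set (s2 := (2 - sigma) * m ^ 2).
  replace (minor s1 s2 c d) with
    (d * ((c ^ 2 + d ^ 2) * (c ^ 2 + d ^ 2 + s2) - s1 * (3 * c ^ 2 - d ^ 2) + s1 * s2))
    by (unfold minor, reE, imF, imE, reF; ring).
  assert (Hm2 : 0 < m ^ 2) by nra.
  assert (H1 : 0 <= s1 <= m ^ 2) by (unfold s1; nra).
  assert (H2 : 0 <= s2) by (unfold s2; nra).
  assert (Hmc : 100 * m ^ 2 <= c ^ 2) by nra.
  assert (Hc2 : 1 <= c ^ 2) by nra.
  assert (Hd2 : c ^ 2 <= d ^ 2 <= 4 * c ^ 2) by nra.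
  assert (1 <= (c ^ 2 + d ^ 2) * (c ^ 2 + d ^ 2 + s2) - s1 * (3 * c ^ 2 - d ^ 2) + s1 * s2).
  { assert (0 <= s1 * s2) by nra.
    assert (s1 * (3 * c ^ 2 - d ^ 2) <= c ^ 2 * c ^ 2) by nra.
    assert (2 * c ^ 2 * c ^ 2 <= (c ^ 2 + d ^ 2) * (c ^ 2 + d ^ 2 + s2)) by nra.
    nra. }
  nra.
Qed.

Lemma symbol_bounds (sigma m c d r : R) :
  0 < sigma < 1 -> 0 < m -> 10 * m <= c -> 1 <= c -> c <= d <= 2 * c -> Rabs r <= 3 * c ->
  let s1 := sigma * m ^ 2 in
  let s2 := (2 - sigma) * m ^ 2 in
  let T := 40 * c ^ 3 in
  Rabs (symE s1 r) <= T /\ Rabs (symF s2 r) <= T /\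
  Rabs (reE s1 c d) <= T /\ Rabs (imE c d) <= T /\
  Rabs (reF s2 c d) <= T /\ Rabs (imF s2 c d) <= T.
Proof.
  intros Hs Hm Hc Hc1 Hd Hr s1 s2 T.
  assert (Hm2 : 0 < m ^ 2) by nra.
  assert (Hc2 : 1 <= c ^ 2) by nra.
  assert (Hmc : 100 * m ^ 2 <= c ^ 2) by nra.
  assert (H1 : Rabs s1 <= c ^ 2) by (unfold s1; rewrite Rabs_pos_eq; nra).
  assert (H2 : Rabs s2 <= c ^ 2) by (unfold s2; rewrite Rabs_pos_eq; nra).
  assert (Hcc : Rabs c <= c) by (rewrite Rabs_pos_eq; lra).
  assert (Hdd : Rabs d <= 2 * c) by (rewrite Rabs_pos_eq; lra).
  assert (Hr2 : Rabs (r ^ 2) <= 9 * c ^ 2).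
  { replace (9 * c ^ 2) with (3 * c * (3 * c)) by ring.
    replace (r ^ 2) with (r * r) by ring; now apply Rabs_mult_le. }
  assert (Hcc2 : Rabs (c ^ 2) <= c ^ 2) by (rewrite Rabs_pos_eq; lra).
  assert (Hdd2 : Rabs (d ^ 2) <= 4 * c ^ 2) by (rewrite Rabs_pos_eq; nra).
  assert (H3 : Rabs 3 <= 3) by (rewrite Rabs_pos_eq; lra).
  assert (H4 : Rabs 2 <= 2) by (rewrite Rabs_pos_eq; lra).
  assert (Hc3 : 0 <= c ^ 2 * (c - 1)) by nra.
  unfold T, symE, symF, reE, imE, reF, imF; repeat split;
    (eapply Rle_trans;
     [repeat first [eassumption | apply Rabs_minus_le | apply Rabs_plus_le
                   | apply Rabs_mult_le] | nra]).
Qed.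

Lemma bc_det_asymptotic (l sigma m a kappa : R) :
  0 < l -> 0 < sigma < 1 -> 0 < m -> - m <= a <= 0 -> 0 < kappa ->
  exists C0, 0 < C0 /\ forall c, C0 <= c ->
    let s1 := sigma * m ^ 2 in
    let s2 := (2 - sigma) * m ^ 2 in
    let b := root4 a c in
    let D := symE s1 a * symF s2 b - symE s1 b * symF s2 a in
    let Delta := bc_det l s1 s2 a b c (sqrt (imsq m a c)) in
    (kappa <= D -> 0 < Delta) /\ (D <= - kappa -> Delta < 0).
Proof.
  intros Hl Hs Hm Ha Hk.
  destruct (pow_exp_small (192 * 40 ^ 6) (2 * l) kappa 18) as [C0 [HC0 HC]]; try lra.
  exists (C0 + 10 * m + 1); split; [lra|]; intros c Hc s1 s2 b D Delta.
  destruct (imag_part_bounds m a c) as [_ Hd]; try lra; set (d := sqrt (imsq m a c)) in *.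
  assert (HM := minor_ge1 sigma m c d Hs Hm ltac:(lra) ltac:(lra) Hd); fold s1 s2 in HM.
  assert (Hra : Rabs a <= 3 * c) by (apply Rabs_le; lra).
  assert (Hrb : Rabs b <= 3 * c) by (unfold b, root4; apply Rabs_le; lra).
  destruct (symbol_bounds sigma m c d a) as [HEa [HFa [H1 [H2 [H3 H4]]]]]; try lra.
  destruct (symbol_bounds sigma m c d b) as [HEb [HFb _]]; try lra.
  fold s1 s2 in HEa, HFa, H1, H3, H4, HEb, HFb.
  assert (Hexp : forall r, r <= 0 -> exp (2 * (r - c) * l) <= exp (- (2 * l * c))).
  { intros r [Hr| ->]; [left; apply exp_increasing; nra | right; f_equal; ring]. }
  assert (HB := bc_det_bound l s1 s2 a b c d (40 * c ^ 3) (exp (- (2 * l * c)))).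
  assert (HB' : Rabs (Delta - minor s1 s2 c d ^ 2 * D) < kappa).
  { eapply Rle_lt_trans; [apply HB; try assumption|].
    - assert (0 <= c ^ 3) by (apply pow_le; lra); lra.
    - rewrite <- exp_0; left; apply exp_increasing; nra.
    - apply Hexp; lra.
    - apply Hexp; unfold b, root4; lra.
    - replace (192 * (40 * c ^ 3) ^ 6) with (192 * 40 ^ 6 * c ^ 18) by ring.
      apply HC; lra. }
  apply Rabs_def2 in HB'.
  assert (HM2 : 1 <= minor s1 s2 c d ^ 2) by nra.
  split; intros HD; nra.
Qed.

Lemma left_det_pos (sigma m c : R) :
  0 < sigma < 1 -> 0 < m -> 10 * m <= c -> 1 <= c ->
  let s1 := sigma * m ^ 2 in
  let s2 := (2 - sigma) * m ^ 2 in
  let a := - (sigma * m) in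
  let b := root4 a c in
  sigma * (1 - sigma) * m ^ 2 <= symE s1 a * symF s2 b - symE s1 b * symF s2 a.
Proof.
  intros Hs Hm Hc Hc1 s1 s2 a b.
  replace (symE s1 a * symF s2 b - symE s1 b * symF s2 a) with
    (sigma * (1 - sigma) * m ^ 2 * (- symF s2 b - (2 + sigma) * m * symE s1 b))
    by (unfold symE, symF, s1, s2, a; ring).
  rewrite <- (Rmult_1_r (sigma * (1 - sigma) * m ^ 2)) at 1.
  assert (0 < sigma * (1 - sigma)) by nra.
  assert (Hm2 : 0 < m ^ 2) by nra.
  apply Rmult_le_compat_l; [nra|].
  set (t := - b); replace b with (- t) by (unfold t; ring).
  assert (Ht : 2 * c - m <= t <= 2 * c) by (unfold t, b, root4, a; nra).
  replace (- symF s2 (- t) - (2 + sigma) * m * symE s1 (- t))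
    with (t * (t ^ 2 - s2) - (2 + sigma) * m * (t ^ 2 - s1)) by (unfold symE, symF; ring).
  assert (Hs1 : 0 <= s1) by (unfold s1; nra).
  assert (Hs2 : s2 <= 2 * m ^ 2) by (unfold s2; nra).
  assert (Htm : 19 * m <= t) by lra.
  assert (Ht1 : 1 <= t) by lra.
  assert (H1 : (2 + sigma) * m * (t ^ 2 - s1) <= 3 * m * t ^ 2).
  { assert (0 <= t ^ 2) by nra. assert (0 <= (2 + sigma) * m) by nra.
    apply Rle_trans with ((2 + sigma) * m * t ^ 2); [apply Rmult_le_compat_l; lra|].
    apply Rmult_le_compat_r; nra. }
  assert (H2 : t * (t ^ 2 - 2 * m ^ 2) <= t * (t ^ 2 - s2)) by nra.
  assert (H3 : 361 * m ^ 2 <= t ^ 2) by nra.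
  assert (H4 : 3 * m * t ^ 2 <= t * t ^ 2 / 3) by nra.
  assert (H5 : 1 <= t ^ 2) by nra.
  assert (H6 : 1 <= t * t ^ 2) by nra.
  assert (H7 : t * (2 * m ^ 2) <= t * t ^ 2 / 3) by nra.
  nra.
Qed.

Lemma left_det_neg (sigma m c : R) :
  0 < sigma < 1 -> 0 < m -> 10 * m <= c -> 1 <= c ->
  let s1 := sigma * m ^ 2 in
  let s2 := (2 - sigma) * m ^ 2 in
  let a := - m in
  let b := root4 a c in
  symE s1 a * symF s2 b - symE s1 b * symF s2 a <= - (sigma * (1 - sigma) * m ^ 2).
Proof.
  intros Hs Hm Hc Hc1 s1 s2 a b.
  replace (symE s1 a * symF s2 b - symE s1 b * symF s2 a) with
    (- ((1 - sigma) * m ^ 2 * (- symF s2 b + m * symE s1 b)))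
    by (unfold symE, symF, s1, s2, a; ring).
  apply Ropp_le_contravar.
  replace (sigma * (1 - sigma) * m ^ 2) with ((1 - sigma) * m ^ 2 * sigma) by ring.
  assert (Hm2 : 0 < m ^ 2) by nra.
  apply Rmult_le_compat_l; [nra|].
  set (t := - b); replace b with (- t) by (unfold t; ring).
  assert (Ht : 2 * c - m <= t <= 2 * c) by (unfold t, b, root4, a; nra).
  replace (- symF s2 (- t) + m * symE s1 (- t))
    with (t * (t ^ 2 - s2) + m * (t ^ 2 - s1)) by (unfold symE, symF; ring).
  assert (Hs1 : s1 <= m ^ 2) by (unfold s1; nra).
  assert (Hs2 : s2 <= 2 * m ^ 2) by (unfold s2; nra).
  assert (H3 : 361 * m ^ 2 <= t ^ 2) by nra.
  assert (H5 : 1 <= t ^ 2) by nra.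
  assert (0 <= m * (t ^ 2 - s1)) by nra.
  assert (H2 : 1 * (t ^ 2 - 2 * m ^ 2) <= t * (t ^ 2 - s2)) by nra.
  assert (t ^ 2 <= 2 * (t ^ 2 - 2 * m ^ 2)) by nra.
  assert (Ht2 : 3 <= t ^ 2) by nra.
  lra.
Qed.

Lemma cpt_plus (f g : R -> R) (x : R) :
  continuity_pt f x -> continuity_pt g x -> continuity_pt (fun t => f t + g t) x.
Proof. exact (continuity_pt_plus f g x). Qed.
Lemma cpt_minus (f g : R -> R) (x : R) :
  continuity_pt f x -> continuity_pt g x -> continuity_pt (fun t => f t - g t) x.
Proof. exact (continuity_pt_minus f g x). Qed.
Lemma cpt_mult (f g : R -> R) (x : R) :
  continuity_pt f x -> continuity_pt g x -> continuity_pt (fun t => f t * g t) x.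
Proof. exact (continuity_pt_mult f g x). Qed.
Lemma cpt_opp (f : R -> R) (x : R) :
  continuity_pt f x -> continuity_pt (fun t => - f t) x.
Proof. exact (continuity_pt_opp f x). Qed.
Lemma cpt_const (k x : R) : continuity_pt (fun _ => k) x.
Proof. apply continuity_pt_const; intros u v; reflexivity. Qed.
Lemma cpt_pow (f : R -> R) (n : nat) (x : R) :
  continuity_pt f x -> continuity_pt (fun t => f t ^ n) x.
Proof.
  intros Hf; induction n as [|n IH]; [exact (cpt_const 1 x)|].
  exact (cpt_mult f (fun t => f t ^ n) x Hf IH).
Qed.
Lemma cpt_comp (f g : R -> R) (x : R) :
  continuity_pt f x -> continuity_pt g (f x) -> continuity_pt (fun t => g (f t)) x.
Proof. exact (continuity_pt_comp f g x). Qed.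
Lemma cpt_exp (f : R -> R) (x : R) : continuity_pt f x -> continuity_pt (fun t => exp (f t)) x.
Proof. intros; apply cpt_comp; [|apply derivable_continuous, derivable_exp]; easy. Qed.
Lemma cpt_cos (f : R -> R) (x : R) : continuity_pt f x -> continuity_pt (fun t => cos (f t)) x.
Proof. intros; apply cpt_comp; [|apply continuity_cos]; easy. Qed.
Lemma cpt_sin (f : R -> R) (x : R) : continuity_pt f x -> continuity_pt (fun t => sin (f t)) x.
Proof. intros; apply cpt_comp; [|apply continuity_sin]; easy. Qed.
Lemma cpt_sqrt (f : R -> R) (x : R) :
  0 <= f x -> continuity_pt f x -> continuity_pt (fun t => sqrt (f t)) x.
Proof. intros; apply cpt_comp; [|now apply continuity_pt_sqrt]; easy. Qed.

Ltac cpt :=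
  repeat first [assumption | apply cpt_const | apply derivable_continuous_pt, derivable_pt_id
    | apply cpt_plus | apply cpt_minus | apply cpt_mult | apply cpt_opp | apply cpt_pow
    | apply cpt_exp | apply cpt_cos | apply cpt_sin].

Lemma bc_det_continuous (l s1 s2 : R) (a b c d : R -> R) (x : R) :
  continuity_pt a x -> continuity_pt b x -> continuity_pt c x -> continuity_pt d x ->
  continuity_pt (fun t => bc_det l s1 s2 (a t) (b t) (c t) (d t)) x.
Proof.
  intros Ha Hb Hc Hd.
  assert (HreE : continuity_pt (fun t => reE s1 (c t) (d t)) x) by (unfold reE; cpt).
  assert (HimE : continuity_pt (fun t => imE (c t) (d t)) x) by (unfold imE; cpt).
  assert (HreF : continuity_pt (fun t => reF s2 (c t) (d t)) x) by (unfold reF; cpt).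
  assert (HimF : continuity_pt (fun t => imF s2 (c t) (d t)) x) by (unfold imF; cpt).
  assert (Hres : forall r, continuity_pt r x ->
            continuity_pt (fun t => resE l s1 s2 (c t) (d t) (r t)) x /\
            continuity_pt (fun t => resF l s1 s2 (c t) (d t) (r t)) x).
  { intros r Hr.
    assert (HE : continuity_pt (fun t => symE s1 (r t)) x) by (unfold symE; cpt).
    assert (HF : continuity_pt (fun t => symF s2 (r t)) x) by (unfold symF; cpt).
    unfold resE, resF, tailE, tailF, minor, cofC, cofD; split; cpt. }
  destruct (Hres a Ha); destruct (Hres b Hb); unfold bc_det; cpt.
Qed.

Lemma drift_surj (m a c0 beta : R) :
  0 < m -> - m <= a <= 0 -> 10 * m <= c0 -> 1 <= c0 -> 8 * c0 ^ 3 < beta ->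
  exists c, c0 <= c /\ drift m a c = beta.
Proof.
  intros Hm Ha Hc Hc1 Hb.
  assert (Hc03 : 0 < c0 ^ 3) by (apply pow_lt; lra).
  destruct (IVT_interv (fun c => drift m a c - beta) c0 (c0 + beta)) as [c [Hcc H]].
  - intros; unfold drift; cpt.
  - lra.
  - assert (drift m a c0 <= 8 * c0 ^ 3); [unfold drift|lra].
    assert (a * (2 * c0 + a) <= 0) by nra. assert (0 <= m ^ 2) by nra. nra.
  - unfold drift; set (c := c0 + beta).
    assert (c ^ 2 <= 2 * c ^ 2 + 2 * a * c + a ^ 2 - m ^ 2) by (unfold c; nra).
    assert (1 <= c) by (unfold c; lra). assert (1 <= c ^ 2) by nra.
    assert (c <= 4 * c * (2 * c ^ 2 + 2 * a * c + a ^ 2 - m ^ 2)) by nra.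
    unfold c in *; lra.
  - exists c; split; [apply Hcc | lra].
Qed.

(** [drift m a c = beta] reads [(a + c)^2 = beta / (4 c) + m^2 - c^2], which
    gives the level curve of [drift] as a graph [a = level_root m beta c]. *)
Definition level_sq (m beta c : R) : R := beta / (4 * c) + m ^ 2 - c ^ 2.
Definition level_root (m beta c : R) : R := sqrt (level_sq m beta c) - c.

Lemma level_sq_drift (m a c : R) :
  0 < c -> level_sq m (drift m a c) c = (a + c) ^ 2.
Proof. intros; unfold level_sq, drift; field; lra. Qed.

Lemma level_root_drift (m a c : R) :
  0 < c -> 0 <= a + c -> level_root m (drift m a c) c = a.
Proof.
  intros Hc Ha; unfold level_root; rewrite level_sq_drift, sqrt_pow2 by lra; ring.
Qed.

Lemma drift_level_root (m beta c : R) :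
  0 < c -> 0 <= level_sq m beta c -> drift m (level_root m beta c) c = beta.
Proof.
  intros Hc H; unfold drift, level_root.
  assert (Hs := pow2_sqrt _ H); set (w := sqrt (level_sq m beta c)) in *.
  replace (4 * c * _) with (4 * c * (c ^ 2 - m ^ 2 + w ^ 2)) by ring.
  rewrite Hs; unfold level_sq; field; lra.
Qed.

Lemma level_sq_decr (m beta c c' : R) :
  0 < beta -> 0 < c <= c' -> level_sq m beta c' <= level_sq m beta c.
Proof.
  intros Hb Hc; unfold level_sq.
  assert (beta / (4 * c') <= beta / (4 * c)).
  { apply Rmult_le_compat_l; [lra|]; apply Rinv_le_contravar; lra. }
  assert (c ^ 2 <= c' ^ 2) by nra; lra.
Qed.

Lemma exists_bc_root (l sigma m : R) (Q : R) :
  0 < l -> 0 < sigma < 1 -> 0 < m ->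
  exists beta0, 0 < beta0 /\ forall beta, beta0 < beta ->
  exists a c, - m <= a <= - (sigma * m) /\ 10 * m <= c /\ 1 <= c /\ Q <= c /\
    drift m a c = beta /\
    bc_det l (sigma * m ^ 2) ((2 - sigma) * m ^ 2) a (root4 a c) c (sqrt (imsq m a c)) = 0.
Proof.
  intros Hl Hs Hm.
  set (kappa := sigma * (1 - sigma) * m ^ 2).
  assert (Hk : 0 < kappa).
  { unfold kappa; apply Rmult_lt_0_compat; [nra | apply pow_lt; lra]. }
  assert (Hsm : 0 < sigma * m <= m) by nra.
  destruct (bc_det_asymptotic l sigma m (- (sigma * m)) kappa) as [C1 [HC1 HD1]]; try lra.
  destruct (bc_det_asymptotic l sigma m (- m) kappa) as [C2 [HC2 HD2]]; try lra.
  set (c0 := C1 + C2 + 10 * m + 1 + Rabs Q).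
  assert (HQ := Rle_abs Q); assert (HQ' := Rabs_pos Q).
  assert (Hc0 : 10 * m <= c0 /\ 1 <= c0 /\ Q <= c0 /\ C1 <= c0 /\ C2 <= c0)
    by (unfold c0; lra).
  clearbody c0; destruct Hc0 as [Hc0m [Hc01 [Hc0Q [Hc0C1 Hc0C2]]]].
  assert (Hc03 : 0 < c0 ^ 3) by (apply pow_lt; lra).
  exists (8 * c0 ^ 3); split; [lra|]; intros beta Hbeta.
  destruct (drift_surj m (- (sigma * m)) c0 beta) as [c1 [Hc1 Hd1]]; try lra.
  destruct (drift_surj m (- m) c0 beta) as [c2 [Hc2 Hd2]]; try lra.
  assert (Hr1 : level_root m beta c1 = - (sigma * m))
    by (rewrite <- Hd1; apply level_root_drift; lra).
  assert (Hr2 : level_root m beta c2 = - m)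
    by (rewrite <- Hd2; apply level_root_drift; lra).
  assert (Hq1 : level_sq m beta c1 = (c1 - sigma * m) ^ 2)
    by (rewrite <- Hd1, level_sq_drift by lra; ring).
  assert (Hq2 : level_sq m beta c2 = (c2 - m) ^ 2)
    by (rewrite <- Hd2, level_sq_drift by lra; ring).
  assert (Hc12 : c1 < c2).
  { apply Rnot_le_lt; intros Hle.
    assert (H := level_sq_decr m beta c2 c1 ltac:(lra) ltac:(lra)).
    assert (Hlt : c2 - m < c1 - sigma * m) by nra.
    assert (0 < c2 - m) by lra. nra. }
  assert (Hrange : forall c, c1 <= c <= c2 ->
            0 < level_sq m beta c /\ - m <= level_root m beta c <= - (sigma * m)).
  { intros c Hc.
    assert (H1 := level_sq_decr m beta c1 c ltac:(lra) ltac:(lra)).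
    assert (H2 := level_sq_decr m beta c c2 ltac:(lra) ltac:(lra)).
    assert (0 < (c2 - m) ^ 2) by (apply pow_lt; lra).
    rewrite Hq1 in H1; rewrite Hq2 in H2.
    assert (0 < level_sq m beta c) by lra.
    apply sqrt_le_1_alt in H1; apply sqrt_le_1_alt in H2.
    rewrite sqrt_pow2 in H1 by lra; rewrite sqrt_pow2 in H2 by lra.
    unfold level_root; split; [assumption | lra]. }
  set (g := fun c => - bc_det l (sigma * m ^ 2) ((2 - sigma) * m ^ 2) (level_root m beta c)
              (root4 (level_root m beta c) c) c (sqrt (imsq m (level_root m beta c) c))).
  destruct (IVT_interv g c1 c2) as [c [Hc Hg]].
  - intros c Hc; destruct (Hrange c Hc) as [Hpos Hr].
    assert (Hcont : continuity_pt (level_root m beta) c).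
    { unfold level_root; apply cpt_minus; [|cpt].
      apply cpt_sqrt; [lra|]; unfold level_sq; cpt.
      apply continuity_pt_inv; [cpt | lra]. }
    assert (Himsq := imsq_bounds m (level_root m beta c) c Hm ltac:(lra) ltac:(lra)).
    apply cpt_opp, bc_det_continuous; unfold root4; cpt.
    apply cpt_sqrt; [nra|]; unfold imsq; cpt.
  - assumption.
  - unfold g; rewrite Hr1.
    assert (H := left_det_pos sigma m c1 Hs Hm ltac:(lra) ltac:(lra)).
    apply (proj1 (HD1 c1 ltac:(lra))) in H; lra.
  - unfold g; rewrite Hr2.
    assert (H := left_det_neg sigma m c2 Hs Hm ltac:(lra) ltac:(lra)).
    apply (proj2 (HD2 c2 ltac:(lra))) in H; lra.
  - destruct (Hrange c Hc) as [Hpos Hr].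
    exists (level_root m beta c), c; repeat split; try lra.
    + apply drift_level_root; lra.
    + unfold g in Hg; lra.
Qed.

Lemma exists_eigenfunction (l sigma m K : R) :
  0 < l -> 0 < sigma < 1 -> 0 < m ->
  exists beta0, 0 < beta0 /\ forall beta, beta0 < beta ->
  exists (kappa : R) (psi : R -> R),
    K < kappa /\ smooth psi /\
    (forall y, Derive_n psi 4 y - 2 * m ^ 2 * Derive_n psi 2 y + beta * Derive psi y
               + kappa * psi y = 0) /\
    (forall y, y = - l \/ y = l ->
       Derive_n psi 2 y - sigma * m ^ 2 * psi y = 0 /\
       Derive_n psi 3 y - (2 - sigma) * m ^ 2 * Derive psi y = 0) /\
    exists y, - l < y < l /\ psi y <> 0.
Proof.
  intros Hl Hs Hm.
  assert (Hsm : 0 < sigma * m <= m) by nra.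
  destruct (exists_bc_root l sigma m (Rabs K / (sigma * m) + 1)) as [beta0 [H0 H]];
    try assumption.
  exists beta0; split; [assumption|]; intros beta Hbeta.
  destruct (H beta Hbeta) as [a [c [Ha [Hc [Hc1 [HcK [Hdr Hdet]]]]]]].
  destruct (imag_part_bounds m a c Hm ltac:(lra) ltac:(lra)) as [Hd2 Hd].
  set (d := sqrt (imsq m a c)) in *.
  assert (HM := minor_ge1 sigma m c d Hs Hm Hc Hc1 Hd).
  destruct (mode_bc l (sigma * m ^ 2) ((2 - sigma) * m ^ 2) a (root4 a c) c d)
    as [A [B [C [D [Hbc Hne]]]]]; try assumption; try lra.
  { unfold root4; lra. }
  exists (level m a c), (mode l a (root4 a c) c d A B C D).
  split; [|split; [|split; [|split; [exact Hbc | exact Hne]]]].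
  - assert (HK := Rle_abs K); assert (HK0 := Rabs_pos K).
    assert (HKc : Rabs K < sigma * m * c).
    { apply Rlt_le_trans with (sigma * m * (Rabs K / (sigma * m) + 1)).
      - replace (sigma * m * (Rabs K / (sigma * m) + 1)) with (Rabs K + sigma * m)
          by (field; lra); lra.
      - apply Rmult_le_compat_l; lra. }
    unfold level; rewrite <- Hd2; unfold root4.
    assert (Hab : sigma * m * c <= a * (-2 * c - a)) by nra.
    assert (1 <= c ^ 2 + d ^ 2) by nra.
    nra.
  - apply smooth_mode.
  - intros y; rewrite <- Hdr; now apply mode_ode.
Qed.

(** * Separated functions and stationary profiles *)

Definition wave (m A B x : R) : R := A * sin (m * x) + B * cos (m * x).

Lemma is_derive_wave (m A B x : R) :
  is_derive (wave m A B) x (wave m (- m * B) (m * A) x).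
Proof. unfold wave; auto_derive; [easy | ring]. Qed.

Lemma Derive_wave (m A B : R) : Derive (wave m A B) = wave m (- m * B) (m * A).
Proof.
  apply functional_extensionality; intros x; apply is_derive_unique, is_derive_wave.
Qed.

Lemma smooth_wave (m A B : R) : smooth (wave m A B).
Proof.
  intros n; revert A B; induction n as [|n IH]; intros A B x; [easy|].
  apply ex_derive_n_S_Derive.
  - intros y; eexists; apply is_derive_wave.
  - rewrite Derive_wave; apply IH.
Qed.

Definition sinm (m : R) : R -> R := wave m 1 0.

Lemma sinm_eq (m x : R) : sinm m x = sin (m * x).
Proof. unfold sinm, wave; ring. Qed.

Lemma Derive_n_sinm (m x : R) :
  Derive (sinm m) x = m * cos (m * x) /\
  Derive_n (sinm m) 2 x = - m ^ 2 * sinm m x /\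
  Derive_n (sinm m) 4 x = m ^ 4 * sinm m x.
Proof.
  unfold sinm; simpl Derive_n; rewrite !Derive_wave; unfold wave; repeat split; ring.
Qed.

Lemma smooth_Derive (f : R -> R) : smooth f -> smooth (Derive f).
Proof.
  intros Hf n x; destruct n as [|n]; [easy|].
  change (ex_derive (Derive_n (Derive f) n) x); rewrite <- Derive_n_S_Derive.
  apply (Hf (S (S n)) x).
Qed.

Lemma smooth_Derive_n (f : R -> R) (n : nat) : smooth f -> smooth (Derive_n f n).
Proof. intros Hf; induction n as [|n IH]; [exact Hf | exact (smooth_Derive _ IH)]. Qed.

Lemma smooth_continuous (f : R -> R) (x : R) : smooth f -> continuous f x.
Proof. intros Hf; apply (ex_derive_continuous f x), (Hf 1%nat). Qed.

Lemma smooth_scal (k : R) (f : R -> R) : smooth f -> smooth (fun x => k * f x).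
Proof. intros Hf n x; apply ex_derive_n_scal_l, Hf. Qed.

Definition tensor (g f : R -> R) (x y : R) : R := g y * f x.

Lemma pd_tensor (g f : R -> R) (i j : nat) (x y : R) :
  pd i j (tensor g f) x y = Derive_n g j y * Derive_n f i x.
Proof.
  unfold partial_derive, tensor.
  rewrite (Derive_n_ext _ (fun t => Derive_n g j y * f t));
    [apply Derive_n_scal_l | intros t; apply Derive_n_scal_r].
Qed.

Lemma pd_scal (k : R) (u : R -> R -> R) (i j : nat) (x y : R) :
  pd i j (fun x y => k * u x y) x y = k * pd i j u x y.
Proof.
  unfold partial_derive.
  rewrite (Derive_n_ext _ (fun t => k * Derive_n (fun z => u t z) j y));
    [apply Derive_n_scal_l | intros t; apply Derive_n_scal_l].
Qed.

Lemma tensor_scal (k : R) (g f : R -> R) :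
  (fun x y => k * tensor g f x y) = tensor (fun y => k * g y) f.
Proof.
  apply functional_extensionality; intros x; apply functional_extensionality; intros y.
  unfold tensor; ring.
Qed.

Lemma continuity_2d_tensor (g f : R -> R) (x y : R) :
  continuous g y -> continuous f x -> continuity_2d_pt (tensor g f) x y.
Proof.
  intros Hg Hf; apply continuity_2d_pt_mult.
  - apply (continuity_1d_2d_pt_comp g (fun _ v => v));
      [now apply continuity_pt_filterlim | apply continuity_2d_pt_id2].
  - apply (continuity_1d_2d_pt_comp f (fun u _ => u));
      [now apply continuity_pt_filterlim | apply continuity_2d_pt_id1].
Qed.

Lemma ex_diff_n_tensor (g f : R -> R) (n : nat) (x y : R) :
  smooth g -> smooth f -> ex_diff_n (tensor g f) n x y.
Proof.
  revert g f; induction n as [|n IH]; intros g f Hg Hf.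
  - split; [|easy]; apply continuity_2d_tensor; now apply smooth_continuous.
  - split; [apply continuity_2d_tensor; now apply smooth_continuous|].
    split; [apply ex_derive_scal, (Hf 1%nat)|].
    split; [apply (ex_derive_n_scal_r g 1), (Hg 1%nat)|].
    replace (fun u v => Derive (fun z => tensor g f z v) u) with (tensor g (Derive f)).
    + replace (fun u v => Derive (fun z => tensor g f u z) v) with (tensor (Derive g) f).
      * split; apply IH; auto using smooth_Derive.
      * apply functional_extensionality; intros u; apply functional_extensionality; intros v.
        symmetry; apply (Derive_n_scal_r g 1).
    + apply functional_extensionality; intros u; apply functional_extensionality; intros v.
      symmetry; apply Derive_scal.
Qed.

Lemma RInt_scal_R (k : R) (f : R -> R) (a b : R) :
  (forall x, continuous f x) -> RInt (fun x => k * f x) a b = k * RInt f a b.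
Proof.
  intros Hf; apply (RInt_scal f a b k), (ex_RInt_continuous f); auto.
Qed.

Lemma continuous_pow2 (f : R -> R) (x : R) :
  continuous f x -> continuous (fun t => f t ^ 2) x.
Proof.
  intros Hf; apply continuous_ext with (fun t => mult (f t) (f t)).
  - intros t; unfold mult; simpl; ring.
  - exact (@continuous_mult R_UniformSpace R_AbsRing f f x Hf Hf).
Qed.

Lemma int_Omega_tensor_sq (l : R) (g f : R -> R) :
  (forall y, continuous g y) -> (forall x, continuous f x) ->
  int_Omega l (fun x y => tensor g f x y ^ 2) =
  RInt (fun y => g y ^ 2) (- l) l * RInt (fun x => f x ^ 2) 0 PI.
Proof.
  intros Hg Hf; unfold int_Omega.
  rewrite <- RInt_scal_R by (intros; now apply continuous_pow2).
  apply RInt_ext; intros x _.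
  rewrite (RInt_ext _ (fun y => f x ^ 2 * g y ^ 2))
    by (intros y _; unfold tensor; simpl; ring).
  rewrite RInt_scal_R by (intros; now apply continuous_pow2); apply Rmult_comm.
Qed.

Lemma RInt_sq_ge0 (f : R -> R) (a b : R) :
  a <= b -> (forall x, continuous f x) -> 0 <= RInt (fun x => f x ^ 2) a b.
Proof.
  intros Hab Hf; apply RInt_ge_0; [exact Hab | |intros; apply pow2_ge_0].
  apply (ex_RInt_continuous (fun x => f x ^ 2)); intros; now apply continuous_pow2.
Qed.

Lemma RInt_sq_gt0 (f : R -> R) (a b x0 : R) :
  (forall x, continuous f x) -> a < x0 < b -> f x0 <> 0 ->
  0 < RInt (fun x => f x ^ 2) a b.
Proof.
  intros Hf Hx0 Hne.
  set (g := fun x => f x ^ 2).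
  assert (Hg : forall x, continuous g x) by (intros; now apply continuous_pow2).
  assert (Hex : forall u v, ex_RInt g u v) by (intros; now apply (ex_RInt_continuous g)).
  assert (Hg0 : 0 < g x0) by now apply pow2_gt_0.
  destruct (proj1 (filterlim_locally _ _) (Hg x0) (mkposreal _ Hg0)) as [del Hdel].
  assert (Hdel' : forall x, Rabs (x - x0) < del -> 0 < g x).
  { intros x Hx; specialize (Hdel x Hx).
    change (Rabs (g x - g x0) < g x0) in Hdel; apply Rabs_def2 in Hdel; lra. }
  assert (Hdp := cond_pos del).
  set (r := Rmin (del / 2) (b - x0)).
  assert (Hr : 0 < r <= del / 2 /\ r <= b - x0).
  { unfold r; repeat split; [apply Rmin_pos; lra | apply Rmin_l | apply Rmin_r]. }
  rewrite <- (RInt_Chasles g a x0 b), <- (RInt_Chasles g x0 (x0 + r) b) by auto.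
  assert (0 <= RInt g a x0) by (apply RInt_sq_ge0; auto; lra).
  assert (0 <= RInt g (x0 + r) b) by (apply RInt_sq_ge0; auto; lra).
  assert (0 < RInt g x0 (x0 + r)).
  { apply RInt_gt_0; auto; [lra|]; intros x Hx; apply Hdel'; apply Rabs_def1; lra. }
  unfold plus; simpl; lra.
Qed.

(** With [beta = - alpha], the separation constant of the stationary problem for
    [psi(y) sin(mx)] with [norm_L2 u_x ^ 2 = N] is [m^4 + m^2 (S N - P)]; since
    [N] is quadratic in [psi], any value above [m^4 - m^2 P] is reached by
    rescaling an eigenfunction. *)
Definition profile (l sigma P S beta m N : R) (psi : R -> R) : Prop :=
  0 < N /\ smooth psi /\
  (forall y, Derive_n psi 4 y - 2 * m ^ 2 * Derive_n psi 2 y + beta * Derive psi y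
             + (m ^ 4 + m ^ 2 * (S * N - P)) * psi y = 0) /\
  (forall y, y = - l \/ y = l ->
     Derive_n psi 2 y - sigma * m ^ 2 * psi y = 0 /\
     Derive_n psi 3 y - (2 - sigma) * m ^ 2 * Derive psi y = 0) /\
  (exists y, - l < y < l /\ psi y <> 0) /\
  int_Omega l (fun x y => pd 1 0 (tensor psi (sinm m)) x y ^ 2) = N.

Lemma int_pd10_tensor (l : R) (g f : R -> R) :
  smooth g -> smooth f ->
  int_Omega l (fun x y => pd 1 0 (tensor g f) x y ^ 2) =
  RInt (fun y => g y ^ 2) (- l) l * RInt (fun x => Derive f x ^ 2) 0 PI.
Proof.
  intros Hg Hf; rewrite <- int_Omega_tensor_sq.
  - f_equal; apply functional_extensionality; intros x;
      apply functional_extensionality; intros y; now rewrite pd_tensor.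
  - intros; now apply smooth_continuous.
  - intros; now apply smooth_continuous, smooth_Derive.
Qed.

Lemma exists_profile (l sigma P S m : R) :
  0 < l -> 0 < sigma < 1 -> 0 < S -> 0 < m ->
  exists beta0, 0 < beta0 /\ forall beta, beta0 < beta ->
  exists N psi, profile l sigma P S beta m N psi.
Proof.
  intros Hl Hs HS Hm.
  destruct (exists_eigenfunction l sigma m (m ^ 4 - m ^ 2 * P)) as [beta0 [H0 H]];
    try assumption.
  exists beta0; split; [assumption|]; intros beta Hbeta.
  destruct (H beta Hbeta) as [kappa [psi [Hk [Hsm [Hode [Hbc [y0 [Hy0 Hne]]]]]]]].
  assert (Hm2 : 0 < m ^ 2) by (apply pow_lt; lra).
  assert (HS2 : 0 < m ^ 2 * S) by (apply Rmult_lt_0_compat; lra).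
  set (N := (kappa - m ^ 4 + m ^ 2 * P) / (m ^ 2 * S)).
  assert (HN : 0 < N) by (apply Rdiv_lt_0_compat; lra).
  set (I := RInt (fun y => psi y ^ 2) (- l) l).
  set (J := RInt (fun x => Derive (sinm m) x ^ 2) 0 PI).
  assert (HI : 0 < I) by (apply RInt_sq_gt0 with y0; auto using smooth_continuous).
  assert (Hpi := PI_RGT_0).
  assert (HJ : 0 < J).
  { set (x0 := PI / 4 / (m + 1)).
    assert (Hx0 : 0 < x0 < PI /\ 0 < m * x0 < PI / 2).
    { unfold x0; assert (Hx : PI / 4 / (m + 1) * (m + 1) = PI / 4) by (field; lra).
      assert (0 < PI / 4 / (m + 1)) by (apply Rdiv_lt_0_compat; lra).
      repeat split; nra. }
    apply RInt_sq_gt0 with x0.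
    - intros; apply smooth_continuous, smooth_Derive, smooth_wave.
    - apply Hx0.
    - rewrite (proj1 (Derive_n_sinm m x0)).
      assert (0 < cos (m * x0)) by (apply cos_gt_0; lra).
      apply Rmult_integral_contrapositive_currified; lra. }
  set (s := sqrt (N / (I * J))).
  assert (HIJ : 0 < I * J) by now apply Rmult_lt_0_compat.
  assert (Hs2 : s ^ 2 = N / (I * J)) by (apply pow2_sqrt; left; now apply Rdiv_lt_0_compat).
  assert (Hs0 : 0 < s) by (apply sqrt_lt_R0; now apply Rdiv_lt_0_compat).
  assert (HD : forall n y, Derive_n (fun y => s * psi y) n y = s * Derive_n psi n y)
    by (intros; apply Derive_n_scal_l).
  assert (HD1 : forall y, Derive (fun y => s * psi y) y = s * Derive psi y)
    by (intros; apply Derive_scal).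
  exists N, (fun y => s * psi y); split; [exact HN|].
  split; [now apply smooth_scal|].
  split; [|split; [|split]].
  - intros y; rewrite !HD, HD1.
    replace (m ^ 4 + m ^ 2 * (S * N - P)) with kappa by (unfold N; field; lra).
    rewrite <- (Rmult_0_r s), <- (Hode y); ring.
  - intros y Hy; rewrite !HD, HD1; destruct (Hbc y Hy) as [H1 H2].
    split; rewrite <- (Rmult_0_r s); [rewrite <- H1 | rewrite <- H2]; ring.
  - exists y0; split; [exact Hy0|]; apply Rmult_integral_contrapositive_currified; lra.
  - rewrite int_pd10_tensor; [|now apply smooth_scal | apply smooth_wave]; fold J.
    rewrite (RInt_ext _ (fun y => s ^ 2 * psi y ^ 2)) by (intros; simpl; ring).
    rewrite RInt_scal_R by (intros; now apply continuous_pow2, smooth_continuous).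
    fold I; rewrite Hs2; field; lra.
Qed.

Lemma Derive_n_0 (f : R -> R) (x : R) : Derive_n f 0 x = f x.
Proof. reflexivity. Qed.

Lemma Derive_n_1 (f : R -> R) (x : R) : Derive_n f 1 x = Derive f x.
Proof. reflexivity. Qed.

Lemma BC_profile (l sigma P S beta N : R) (j : nat) (psi : R -> R) :
  profile l sigma P S beta (INR j) N psi -> BC l sigma (tensor psi (sinm (INR j))).
Proof.
  intros [_ [_ [_ [Hbc _]]]]; split.
  - intros x y Hx _.
    assert (H : sinm (INR j) x = 0).
    { rewrite sinm_eq; destruct Hx as [->| ->]; [rewrite Rmult_0_r; apply sin_0|].
      apply sin_eq_0_1; exists (Z.of_nat j); now rewrite <- INR_IZR_INZ. }
    destruct (Derive_n_sinm (INR j) x) as [_ [H2 _]].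
    rewrite pd_tensor, H2; unfold tensor; rewrite H; split; ring.
  - intros x y _ Hy; destruct (Hbc y Hy) as [H2 H3].
    destruct (Derive_n_sinm (INR j) x) as [_ [Hf2 _]].
    rewrite !pd_tensor, Hf2, Derive_n_1, !Derive_n_0.
    split; rewrite <- (Rmult_0_r (sinm (INR j) x)); [rewrite <- H2 | rewrite <- H3]; ring.
Qed.

Lemma profile_scaled_equation (l sigma P S beta m N s x y : R) (psi : R -> R) :
  profile l sigma P S beta m N psi ->
  let u := fun x y => s * tensor psi (sinm m) x y in
  bilaplacian u x y
  + (P - S * int_Omega l (fun x' y' => pd 1 0 u x' y' ^ 2)) * pd 2 0 u x y
  - - beta * pd 0 1 u x y
  = m ^ 2 * S * N * (s ^ 3 - s) * tensor psi (sinm m) x y.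
Proof.
  intros [_ [Hpsi [Hode [_ [_ HN]]]]] u.
  assert (Hint : int_Omega l (fun x' y' => pd 1 0 u x' y' ^ 2) = s ^ 2 * N).
  { rewrite <- HN; unfold u; rewrite tensor_scal.
    assert (Hf := smooth_wave m 1 0); fold (sinm m) in Hf.
    assert (Hsp := smooth_scal s psi Hpsi).
    rewrite (int_pd10_tensor l _ _ Hsp Hf), (int_pd10_tensor l _ _ Hpsi Hf).
    rewrite (RInt_ext _ (fun y => s ^ 2 * psi y ^ 2)) by (intros; simpl; ring).
    rewrite RInt_scal_R by (intros; now apply continuous_pow2, smooth_continuous); ring. }
  rewrite Hint; unfold bilaplacian, u; rewrite !pd_scal, !pd_tensor.
  destruct (Derive_n_sinm m x) as [_ [H2 H4]]; rewrite H2, H4.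
  specialize (Hode y); rewrite Derive_n_1, !Derive_n_0; unfold tensor.
  assert (H : Derive_n psi 4 y = 2 * m ^ 2 * Derive_n psi 2 y - beta * Derive psi y
             - (m ^ 4 + m ^ 2 * (S * N - P)) * psi y) by lra.
  rewrite H; ring.
Qed.

Lemma solves_ST_profile (l sigma P S beta N : R) (j : nat) (psi : R -> R) :
  profile l sigma P S beta (INR j) N psi ->
  solves_ST l sigma P S (- beta) (tensor psi (sinm (INR j))).
Proof.
  intros Hprof; split; [|split].
  - intros x y; apply ex_diff_n_tensor; [apply Hprof | apply smooth_wave].
  - eapply BC_profile; eassumption.
  - intros x y _.
    assert (H := profile_scaled_equation _ _ _ _ _ _ _ 1 x y _ Hprof); cbv zeta in H.
    rewrite tensor_scal in H.
    replace (fun y => 1 * psi y) with psi in H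
      by (apply functional_extensionality; intros; ring).
    unfold norm_L2; rewrite pow2_sqrt.
    + replace (INR j ^ 2 * S * N * (1 ^ 3 - 1) * tensor psi (sinm (INR j)) x y) with 0 in H by ring.
      rewrite <- H; ring.
    + destruct Hprof as [HN [_ [_ [_ [_ ->]]]]]; lra.
Qed.

Lemma profile_neq0 (l sigma P S beta N : R) (j : nat) (psi : R -> R) :
  (1 <= j)%nat -> profile l sigma P S beta (INR j) N psi ->
  exists x y, Omega l x y /\ tensor psi (sinm (INR j)) x y <> 0.
Proof.
  intros Hj [_ [_ [_ [_ [[y [Hy Hne]] _]]]]].
  assert (HJ : 1 <= INR j) by (change 1 with (INR 1); now apply le_INR).
  assert (Hpi := PI_RGT_0).
  set (x := PI / 2 / INR j).
  assert (Hx : INR j * x = PI / 2) by (unfold x; field; lra).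
  exists x, y; split; [split; [|exact Hy]|].
  - split; [unfold x; apply Rdiv_lt_0_compat; lra|]. nra.
  - unfold tensor; rewrite sinm_eq, Hx, sin_PI2; lra.
Qed.

Lemma unimodal_ST_profile (l sigma P S beta N : R) (j : nat) (psi : R -> R) :
  (1 <= j)%nat -> profile l sigma P S beta (INR j) N psi ->
  unimodal_ST l sigma P S (- beta) j (tensor psi (sinm (INR j))).
Proof.
  intros Hj Hprof; split; [exact Hj|]; split; [now apply (solves_ST_profile _ _ _ _ _ N)|].
  exists psi; split; [apply Hprof|].
  intros x y _; unfold tensor; now rewrite sinm_eq.
Qed.

Lemma continuous_triple (f g h : R -> R) (q : R * R * R) :
  (forall t, continuous f t) -> (forall t, continuous g t) -> (forall t, continuous h t) ->
  continuous (fun p : R * R * R => f (fst (fst p)) * tensor g h (snd (fst p)) (snd p)) q.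
Proof.
  intros Hf Hg Hh; destruct q as [[t x] y]; unfold tensor.
  assert (H1 : continuous (fun p : R * R * R => fst p) (t, x, y)) by apply continuous_fst.
  assert (Ht : continuous (fun p : R * R * R => f (fst (fst p))) (t, x, y)).
  { apply (continuous_comp (fun p : R * R * R => fst (fst p)) f); [|apply Hf].
    apply (continuous_comp (fun p : R * R * R => fst p) fst); [exact H1 | apply continuous_fst]. }
  assert (Hx : continuous (fun p : R * R * R => h (snd (fst p))) (t, x, y)).
  { apply (continuous_comp (fun p : R * R * R => snd (fst p)) h); [|apply Hh].
    apply (continuous_comp (fun p : R * R * R => fst p) snd); [exact H1 | apply continuous_snd]. }
  assert (Hy : continuous (fun p : R * R * R => g (snd p)) (t, x, y)).
  { apply (continuous_comp (fun p : R * R * R => snd p) g); [apply continuous_snd | apply Hg]. }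
  exact (continuous_mult _ _ _ Ht (continuous_mult _ _ _ Hy Hx)).
Qed.

Definition duffing (k w : R) (phi phi1 phi2 : R -> R) : Prop :=
  (forall t, is_derive phi t (phi1 t)) /\ (forall t, is_derive phi1 t (phi2 t)) /\
  (forall t, 0 < t -> phi2 t + k * phi1 t + w * (phi t ^ 3 - phi t) = 0).

Lemma unimodal_PL_duffing (l sigma P S beta k N : R) (j : nat) (psi phi phi1 phi2 : R -> R) :
  (1 <= j)%nat -> profile l sigma P S beta (INR j) N psi ->
  duffing k (INR j ^ 2 * S * N) phi phi1 phi2 ->
  (forall t, continuous phi2 t) ->
  (exists t, 0 <= t /\ phi t <> 0) ->
  let U := tensor psi (sinm (INR j)) in
  unimodal_PL l sigma P S (- beta) k j (fun x y => phi 0 * U x y) (fun x y => phi1 0 * U x y)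
    (fun t x y => phi t * U x y).
Proof.
  intros Hj Hprof [H1 [H2 Hode]] Hc2 Hne U.
  assert (HN := Hprof); destruct HN as [_ [Hpsi [_ [_ [Hpsi0 _]]]]].
  assert (Hf : smooth (sinm (INR j))) by apply smooth_wave.
  assert (D1 : Derive phi = phi1)
    by (apply functional_extensionality; intros t; now apply is_derive_unique).
  assert (D2 : Derive phi1 = phi2)
    by (apply functional_extensionality; intros t; now apply is_derive_unique).
  assert (Hdt : forall n t x y, dt n (fun t x y => phi t * U x y) t x y
                                = Derive_n phi n t * U x y)
    by (intros; apply Derive_n_scal_r).
  assert (Hc0 : forall t, continuous phi t)
    by (intros t; apply (ex_derive_continuous phi t); eexists; apply H1).
  assert (Hc1 : forall t, continuous phi1 t)
    by (intros t; apply (ex_derive_continuous phi1 t); eexists; apply H2).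
  split; [exact Hj|]; split; [split; [|split; [|split]]|].
  - split; [|split; [|split]].
    + intros n t x y Hn; apply ex_derive_n_scal_r.
      destruct n as [|[|[|n]]]; [easy | eexists; apply H1 | | lia].
      change (ex_derive (Derive phi) t); rewrite D1; eexists; apply H2.
    + intros n Hn q.
      apply continuous_ext with
        (fun p => Derive_n phi n (fst (fst p)) * U (snd (fst p)) (snd p)).
      { intros p; symmetry; apply Hdt. }
      apply continuous_triple; try (intros; now apply smooth_continuous).
      destruct n as [|[|[|n]]]; [exact Hc0 | | |lia].
      * change (forall t, continuous (Derive phi) t); now rewrite D1.
      * change (forall t, continuous (Derive (Derive phi)) t); now rewrite D1, D2.
    + intros t x y; unfold U; rewrite tensor_scal.
      apply ex_diff_n_tensor; [now apply smooth_scal | exact Hf].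
    + intros i i' _ q.
      apply continuous_ext with
        (fun p => phi (fst (fst p)) * tensor (Derive_n psi i') (Derive_n (sinm (INR j)) i)
                    (snd (fst p)) (snd p)).
      { intros p; unfold U; rewrite pd_scal, pd_tensor; reflexivity. }
      apply continuous_triple; try exact Hc0;
        intros; now apply smooth_continuous, smooth_Derive_n.
  - intros t _; assert (HBC := BC_profile _ _ _ _ _ _ _ _ Hprof); fold U in HBC.
    destruct HBC as [B1 B2]; split.
    + intros x y Hx Hy; rewrite pd_scal; destruct (B1 x y Hx Hy) as [-> ->]; split; ring.
    + intros x y Hx Hy; rewrite !pd_scal; destruct (B2 x y Hx Hy) as [E1 E2].
      split; rewrite <- (Rmult_0_r (phi t)); [rewrite <- E1 | rewrite <- E2]; ring.
  - intros t x y Ht _; rewrite !Hdt.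
    change (Derive_n phi 2 t) with (Derive (Derive phi) t).
    change (Derive_n phi 1 t) with (Derive phi t); rewrite D1, D2.
    assert (H := profile_scaled_equation _ _ _ _ _ _ _ (phi t) x y _ Hprof).
    cbv zeta in H; fold U in H.
    assert (E : (phi2 t + k * phi1 t + INR j ^ 2 * S * N * (phi t ^ 3 - phi t)) * U x y = 0)
      by (rewrite Hode by exact Ht; ring).
    lra.
  - intros x y _; rewrite Hdt; change (Derive_n phi 1 0) with (Derive phi 0); now rewrite D1.
  - exists phi, psi; repeat split; try assumption.
    intros t x y _ _; unfold U, tensor; rewrite sinm_eq; ring.
Qed.

Lemma duffing_of_solves_PL (l sigma P S beta k N : R) (j : nat) (psi phi : R -> R)
    (u0 v0 : R -> R -> R) :
  (1 <= j)%nat -> profile l sigma P S beta (INR j) N psi ->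
  solves_PL l sigma P S (- beta) k u0 v0
    (fun t x y => phi t * tensor psi (sinm (INR j)) x y) ->
  duffing k (INR j ^ 2 * S * N) phi (Derive phi) (Derive (Derive phi)).
Proof.
  intros Hj Hprof [[Hreg _] [_ [Hpde _]]].
  destruct (profile_neq0 _ _ _ _ _ _ _ _ Hj Hprof) as [x0 [y0 [Hin Hne]]].
  set (U := tensor psi (sinm (INR j))) in *.
  assert (Hex : forall n t, (n <= 2)%nat -> ex_derive_n phi n t).
  { intros n t Hn.
    apply ex_derive_n_ext with (fun s => phi s * U x0 y0 * / U x0 y0).
    - intros s; field; exact Hne.
    - now apply ex_derive_n_scal_r, Hreg. }
  split; [|split].
  - intros t; apply Derive_correct, (Hex 1%nat); lia.
  - intros t; apply Derive_correct, (Hex 2%nat); lia.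
  - intros t Ht; specialize (Hpde t x0 y0 Ht Hin).
    assert (H := profile_scaled_equation _ _ _ _ _ _ _ (phi t) x0 y0 _ Hprof).
    cbv zeta in H; fold U in H.
    unfold dt in Hpde; rewrite !Derive_n_scal_r in Hpde.
    apply (Rmult_eq_reg_r (U x0 y0)); [|exact Hne].
    change (Derive_n phi 2 t) with (Derive (Derive phi) t) in Hpde.
    change (Derive_n phi 1 t) with (Derive phi t) in Hpde.
    lra.
Qed.

Lemma norm_L2_pd_scal (l s : R) (i j : nat) (g f : R -> R) :
  0 < l -> smooth g -> smooth f ->
  norm_L2 l (pd i j (fun x y => s * tensor g f x y)) ^ 2 =
  s ^ 2 * norm_L2 l (pd i j (tensor g f)) ^ 2.
Proof.
  intros Hl Hg Hf.
  assert (Hpd : forall h, pd i j (tensor h f) = tensor (Derive_n h j) (Derive_n f i))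
    by (intros h; apply functional_extensionality; intros x;
        apply functional_extensionality; intros y; apply pd_tensor).
  assert (Hcf : forall x, continuous (Derive_n f i) x)
    by (intros; now apply smooth_continuous, smooth_Derive_n).
  assert (Hcg : forall h, smooth h -> forall x, continuous (Derive_n h j) x)
    by (intros; now apply smooth_continuous, smooth_Derive_n).
  assert (Hpi := PI_RGT_0).
  rewrite tensor_scal, !Hpd; unfold norm_L2.
  rewrite !int_Omega_tensor_sq by auto using smooth_scal.
  rewrite !pow2_sqrt by
    (apply Rmult_le_pos; apply RInt_sq_ge0; auto using smooth_scal; lra).
  rewrite (RInt_ext _ (fun y => s ^ 2 * Derive_n g j y ^ 2))
    by (intros y _; rewrite Derive_n_scal_l; simpl; ring).
  rewrite RInt_scal_R by (intros; apply continuous_pow2; auto); ring.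
Qed.

Lemma norm_H2_scal (l s : R) (g f : R -> R) :
  0 < l -> smooth g -> smooth f ->
  norm_H2 l (fun x y => s * tensor g f x y) = Rabs s * norm_H2 l (tensor g f).
Proof.
  intros Hl Hg Hf; unfold norm_H2.
  change (fun x y => s * tensor g f x y) with (pd 0 0 (fun x y => s * tensor g f x y)) at 1.
  rewrite !norm_L2_pd_scal by assumption.
  rewrite <- !Rmult_plus_distr_l, sqrt_mult_alt by apply pow2_ge_0.
  f_equal; rewrite <- sqrt_Rsqr_abs; f_equal; unfold Rsqr; ring.
Qed.

Definition tends_to (phi : R -> R) (c : R) : Prop :=
  forall eps, 0 < eps -> exists T, forall t, T < t -> Rabs (phi t - c) < eps.

Lemma cvg_H2_tensor (l c : R) (phi g f : R -> R) :
  0 < l -> smooth g -> smooth f -> tends_to phi c ->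
  cvg_H2 l (fun t x y => phi t * tensor g f x y) (fun x y => c * tensor g f x y).
Proof.
  intros Hl Hg Hf Hphi; unfold cvg_H2.
  apply is_lim_ext with (fun t => Rabs (phi t - c) * norm_H2 l (tensor g f)).
  { intros t; rewrite <- norm_H2_scal by assumption; f_equal.
    apply functional_extensionality; intros x; apply functional_extensionality; intros y; ring. }
  set (K := norm_H2 l (tensor g f)).
  assert (HK : 0 <= K) by apply sqrt_pos.
  apply is_lim_spec; intros eps; assert (He := cond_pos eps).
  destruct (Hphi (eps / (K + 1))) as [T HT]; [apply Rdiv_lt_0_compat; lra|].
  exists T; intros t Ht; specialize (HT t Ht).
  rewrite Rminus_0_r, Rabs_pos_eq by (apply Rmult_le_pos; [apply Rabs_pos | exact HK]).
  apply Rle_lt_trans with (Rabs (phi t - c) * (K + 1)).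
  - apply Rmult_le_compat_l; [apply Rabs_pos | lra].
  - apply Rlt_le_trans with (eps / (K + 1) * (K + 1)); [|right; field; lra].
    apply Rmult_lt_compat_r; lra.
Qed.

(** * Convergence for the damped Duffing equation *)

Lemma mean_value (f f' : R -> R) (s t : R) :
  s < t -> (forall x, is_derive f x (f' x)) ->
  exists x, s <= x <= t /\ f t - f s = f' x * (t - s).
Proof.
  intros Hst Hf; destruct (MVT_gen f s t f') as [x [Hx H]].
  - intros; apply Hf.
  - intros x _; apply continuity_pt_filterlim, (ex_derive_continuous f); eexists; apply Hf.
  - exists x; rewrite Rmin_left, Rmax_right in Hx by lra; split; assumption.
Qed.

Lemma Rabs_le_1_sq (x : R) : Rabs x <= 1 + x ^ 2.
Proof. apply Rabs_le; nra. Qed.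

Section DuffingConvergence.

Variables (k w : R) (phi phi1 phi2 : R -> R).
Hypotheses (Hk : 0 < k) (Hw : 0 < w) (Hd : duffing k w phi phi1 phi2).

Let H1 : forall t, is_derive phi t (phi1 t) := proj1 Hd.
Let H2 : forall t, is_derive phi1 t (phi2 t) := proj1 (proj2 Hd).
Let Hode : forall t, 0 < t -> phi2 t + k * phi1 t + w * (phi t ^ 3 - phi t) = 0 :=
  proj2 (proj2 Hd).

Let DphiE (t : R) : Derive (fun x : R => phi x) t = phi1 t := is_derive_unique phi _ _ (H1 t).
Let Dphi1E (t : R) : Derive (fun x : R => phi1 x) t = phi2 t := is_derive_unique phi1 _ _ (H2 t).

Let energy (t : R) : R := phi1 t ^ 2 / 2 + w * (phi t ^ 2 - 1) ^ 2 / 4.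

Lemma is_derive_energy (t : R) :
  is_derive energy t (phi1 t * (phi2 t + w * (phi t ^ 3 - phi t))).
Proof.
  unfold energy; auto_derive.
  - repeat split; eexists; [apply H2 | apply H1].
  - rewrite (DphiE t), (Dphi1E t); field.
Qed.

Lemma energy_drop (s t : R) :
  0 < s < t -> exists x, s <= x <= t /\ energy t - energy s = - k * phi1 x ^ 2 * (t - s).
Proof.
  intros Hst; destruct (mean_value energy _ s t (proj2 Hst) is_derive_energy) as [x [Hx E]].
  exists x; split; [exact Hx|]; rewrite E.
  replace (phi2 x + w * (phi x ^ 3 - phi x)) with (- k * phi1 x)
    by (specialize (Hode x ltac:(lra)); lra); ring.
Qed.

Lemma energy_decr (s t : R) : 0 < s <= t -> energy t <= energy s.
Proof.
  intros [Hs [Hst| ->]]; [|lra].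
  destruct (energy_drop s t ltac:(lra)) as [x [_ E]].
  assert (0 <= phi1 x ^ 2 * (t - s)) by (apply Rmult_le_pos; [apply pow2_ge_0 | lra]).
  nra.
Qed.

Lemma energy_ge0 (t : R) : 0 <= energy t.
Proof.
  assert (0 <= w * (phi t ^ 2 - 1) ^ 2) by (apply Rmult_le_pos; [lra | apply pow2_ge_0]).
  assert (0 <= phi1 t ^ 2) by apply pow2_ge_0.
  unfold energy; lra.
Qed.

Lemma energy_cauchy (eps : R) :
  0 < eps -> exists T, 1 <= T /\ forall t, T <= t -> energy T - energy t < eps.
Proof.
  intros He; apply NNPP; intros Hn.
  assert (Hstep : forall T, 1 <= T -> exists t, T <= t /\ energy t <= energy T - eps).
  { intros T HT; apply NNPP; intros Hn'; apply Hn; exists T; split; [exact HT|].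
    intros t Ht; apply Rnot_le_lt; intros Hle; apply Hn'; exists t; split; [exact Ht | lra]. }
  assert (Hiter : forall n, exists t, 1 <= t /\ energy t <= energy 1 - INR n * eps).
  { induction n as [|n [t [Ht IH]]]; [exists 1; simpl; lra|].
    destruct (Hstep t Ht) as [t' [Ht' E]]; exists t'; rewrite S_INR; lra. }
  destruct (archimed (energy 1 / eps)) as [Hup _].
  assert (H0 := energy_ge0 1).
  assert (Hpos : 0 <= energy 1 / eps) by (apply Rdiv_le_0_compat; lra).
  assert (Hz : (0 <= up (energy 1 / eps))%Z) by (apply le_IZR; lra).
  destruct (Hiter (Z.to_nat (up (energy 1 / eps)))) as [t [_ Ht]].
  rewrite INR_IZR_INZ, Z2Nat.id in Ht by exact Hz.
  assert (energy 1 < IZR (up (energy 1 / eps)) * eps).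
  { apply Rle_lt_trans with (energy 1 / eps * eps); [right; field; lra|].
    apply Rmult_lt_compat_r; lra. }
  assert (H3 := energy_ge0 t); lra.
Qed.

Lemma duffing_bounded :
  exists B, 1 <= B /\ forall t, 1 <= t ->
    Rabs (phi t) <= B /\ Rabs (phi1 t) <= B /\ Rabs (phi2 t) <= B.
Proof.
  set (E := energy 1); assert (HE : 0 <= E) by apply energy_ge0.
  set (B0 := 3 + 4 * E / w); set (B1 := 1 + 2 * E).
  assert (HEw : 0 <= 4 * E / w) by (apply Rdiv_le_0_compat; lra).
  assert (HB : forall t, 1 <= t -> Rabs (phi t) <= B0 /\ Rabs (phi1 t) <= B1).
  { intros t Ht; assert (Hle := energy_decr 1 t ltac:(lra)); fold E in Hle.
    unfold energy in Hle.
    assert (0 <= w * (phi t ^ 2 - 1) ^ 2) by (apply Rmult_le_pos; [lra | apply pow2_ge_0]).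
    assert (0 <= phi1 t ^ 2) by apply pow2_ge_0.
    split.
    - assert (Hq : (phi t ^ 2 - 1) ^ 2 <= 4 * E / w).
      { apply Rmult_le_reg_l with w; [exact Hw|].
        replace (w * (4 * E / w)) with (4 * E) by (field; lra); lra. }
      assert (Hphi := Rabs_le_1_sq (phi t)).
      assert (Hr := Rabs_le_1_sq (phi t ^ 2 - 1)); assert (Hr' := Rle_abs (phi t ^ 2 - 1)).
      unfold B0; lra.
    - assert (Hphi := Rabs_le_1_sq (phi1 t)); unfold B1; lra. }
  set (B2 := k * B1 + w * (B0 * B0 * B0 + B0)).
  assert (HB0 : 1 <= B0) by (unfold B0; lra).
  assert (HB1 : 1 <= B1) by (unfold B1; lra).
  assert (HB2 : 0 <= B2).
  { assert (0 <= B0 * B0) by nra; assert (0 <= B0 * B0 * B0) by nra; unfold B2; nra. }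
  exists (B0 + B1 + B2); split; [lra|]; intros t Ht.
  destruct (HB t Ht) as [Hb0 Hb1]; repeat split; try lra.
  replace (phi2 t) with (- (k * phi1 t + w * (phi t * phi t * phi t - phi t)))
    by (specialize (Hode t ltac:(lra)); simpl in Hode; lra).
  rewrite Rabs_Ropp; apply Rle_trans with B2; [|lra].
  assert (Rabs k <= k) by (rewrite Rabs_pos_eq; lra).
  assert (Rabs w <= w) by (rewrite Rabs_pos_eq; lra).
  unfold B2; repeat first [assumption | apply Rabs_minus_le | apply Rabs_plus_le
                          | apply Rabs_mult_le].
Qed.

(** Barbalat's argument: [phi1] varies slowly, so a large value of it would cost
    a fixed amount of energy. *)
Lemma duffing_velocity : tends_to phi1 0.
Proof.
  intros eps He; destruct duffing_bounded as [B [HB Hbd]].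
  set (delta := eps / (2 * B)).
  assert (Hdel : 0 < delta) by (apply Rdiv_lt_0_compat; lra).
  assert (HBd : B * delta = eps / 2) by (unfold delta; field; lra).
  assert (Hdrop : 0 < k * (eps / 2) ^ 2 * delta).
  { apply Rmult_lt_0_compat; [|exact Hdel]; apply Rmult_lt_0_compat; [exact Hk|].
    apply pow_lt; lra. }
  destruct (energy_cauchy _ Hdrop) as [T [HT Hc]].
  exists T; intros t Ht; rewrite Rminus_0_r; apply Rnot_le_lt; intros Hge.
  destruct (energy_drop t (t + delta) ltac:(lra)) as [x [Hx E]].
  assert (Hx2 : eps / 2 <= Rabs (phi1 x)).
  { destruct (Req_dec x t) as [->|Hxt]; [lra|].
    destruct (mean_value phi1 phi2 t x ltac:(lra) H2) as [z [Hz Ez]].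
    assert (Rabs (phi1 x - phi1 t) <= eps / 2).
    { rewrite Ez, <- HBd; apply Rabs_mult_le; [apply Hbd; lra|].
      rewrite Rabs_pos_eq; lra. }
    assert (Htri := Rabs_triang_inv (phi1 t) (phi1 t - phi1 x)).
    replace (phi1 t - (phi1 t - phi1 x)) with (phi1 x) in Htri by ring.
    rewrite (Rabs_minus_sym (phi1 t)) in Htri; lra. }
  assert (Hsq : (eps / 2) ^ 2 <= phi1 x ^ 2).
  { rewrite <- (pow2_abs (phi1 x)); apply pow_incr; lra. }
  replace (t + delta - t) with delta in E by ring.
  assert (k * (eps / 2) ^ 2 * delta <= k * phi1 x ^ 2 * delta).
  { apply Rmult_le_compat_r; [lra|]; apply Rmult_le_compat_l; lra. }
  assert (Hm := energy_decr T t ltac:(lra)).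
  specialize (Hc (t + delta) ltac:(lra)); lra.
Qed.

Lemma duffing_force : tends_to (fun t => phi t ^ 3 - phi t) 0.
Proof.
  intros eps He; destruct duffing_bounded as [B [HB Hbd]].
  set (L := 3 * B ^ 2 + 1).
  assert (HB2 : 1 <= B ^ 2) by nra.
  set (mu := Rmin (eps / (2 * L)) (w * eps / (4 * (2 + k)))).
  assert (Hwe : 0 < w * eps) by nra.
  assert (Hmu : 0 < mu)
    by (apply Rmin_pos; apply Rdiv_lt_0_compat; unfold L; lra).
  assert (HmuL : L * mu <= eps / 2).
  { apply Rle_trans with (L * (eps / (2 * L))).
    - apply Rmult_le_compat_l; [unfold L; lra | apply Rmin_l].
    - right; field; unfold L; lra. }
  assert (Hmuk : (2 + k) * mu <= w * eps / 4).
  { apply Rle_trans with ((2 + k) * (w * eps / (4 * (2 + k)))).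
    - apply Rmult_le_compat_l; [lra | apply Rmin_r].
    - right; field; lra. }
  destruct (duffing_velocity mu Hmu) as [T HT].
  exists (Rmax T 1); intros t Ht; rewrite Rminus_0_r; apply Rnot_le_lt; intros Hge.
  assert (HTm := Rmax_l T 1); assert (HT1 := Rmax_r T 1).
  destruct (mean_value phi1 phi2 t (t + 1) ltac:(lra) H2) as [x [Hx Ex]].
  assert (Hf : forall z, is_derive (fun t => phi t ^ 3 - phi t) z ((3 * phi z ^ 2 - 1) * phi1 z)).
  { intros z; auto_derive.
    - repeat split; eexists; apply H1.
    - rewrite (DphiE z); ring. }
  assert (Hx2 : eps / 2 <= Rabs (phi x ^ 3 - phi x)).
  { destruct (Req_dec x t) as [->|Hxt]; [lra|].
    destruct (mean_value _ _ t x ltac:(lra) Hf) as [z [Hz Ez]]; cbv beta in Ez.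
    assert (Hdiff : Rabs (phi x ^ 3 - phi x - (phi t ^ 3 - phi t)) <= eps / 2).
    { rewrite Ez; apply Rle_trans with (L * mu * 1); [|lra].
      apply Rabs_mult_le; [apply Rabs_mult_le|].
      - unfold L; apply Rabs_minus_le; [|rewrite Rabs_R1; lra].
        apply Rabs_mult_le; [rewrite Rabs_pos_eq; lra|].
        rewrite <- RPow_abs; apply pow_incr; split; [apply Rabs_pos | apply Hbd; lra].
      - specialize (HT z ltac:(lra)); rewrite Rminus_0_r in HT; lra.
      - rewrite Rabs_pos_eq; lra. }
    set (p := phi t ^ 3 - phi t) in *; set (q := phi x ^ 3 - phi x) in *.
    assert (Htri := Rabs_triang_inv p (p - q)).
    replace (p - (p - q)) with q in Htri by ring.
    rewrite (Rabs_minus_sym p) in Htri; lra. }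
  assert (Hx1 := HT x ltac:(lra)); assert (Ht0 := HT t ltac:(lra)).
  assert (Ht1 := HT (t + 1) ltac:(lra)); rewrite Rminus_0_r in Hx1, Ht0, Ht1.
  replace (phi2 x * (t + 1 - t)) with (- (k * phi1 x) - w * (phi x ^ 3 - phi x)) in Ex
    by (specialize (Hode x ltac:(lra)); lra).
  assert (Hforce : w * (phi x ^ 3 - phi x) = - (k * phi1 x) - phi1 (t + 1) + phi1 t) by lra.
  assert (Hup : Rabs (w * (phi x ^ 3 - phi x)) <= k * mu + mu + mu).
  { rewrite Hforce; apply Rabs_plus_le; [apply Rabs_minus_le|]; try lra.
    rewrite Rabs_Ropp; apply Rabs_mult_le; [rewrite Rabs_pos_eq; lra | lra]. }
  rewrite Rabs_mult, (Rabs_pos_eq w) in Hup by lra.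
  assert (w * (eps / 2) <= w * Rabs (phi x ^ 3 - phi x)) by (apply Rmult_le_compat_l; lra).
  lra.
Qed.

Lemma duffing_side (c T s t : R) :
  (forall r, T < r -> phi r <> c) -> T < s -> T < t -> c < phi s -> c < phi t.
Proof.
  intros Hne Hs Ht Hc; apply Rnot_le_lt; intros Hle.
  destruct (IVT_gen phi s t c) as [r [Hr Er]].
  - intros r; apply continuity_pt_filterlim, (ex_derive_continuous phi); eexists; apply H1.
  - split; [rewrite Rmin_right | rewrite Rmax_left]; lra.
  - apply (Hne r); [|exact Er].
    assert (T < Rmin s t) by now apply Rmin_glb_lt.
    lra.
Qed.

Lemma duffing_limit : tends_to phi 0 \/ tends_to phi 1 \/ tends_to phi (- 1).
Proof.
  destruct (duffing_force (3 / 8) ltac:(lra)) as [T HT].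
  assert (Hp : forall r, T < r -> phi r <> 1 / 2).
  { intros r Hr E; specialize (HT r Hr); rewrite E in HT; apply Rabs_def2 in HT; lra. }
  assert (Hm : forall r, T < r -> phi r <> - (1 / 2)).
  { intros r Hr E; specialize (HT r Hr); rewrite E in HT; apply Rabs_def2 in HT; lra. }
  assert (Hlim : forall e,
    (forall t, T < t -> 3 / 4 * Rabs (phi t - e) <= Rabs (phi t ^ 3 - phi t)) -> tends_to phi e).
  { intros e Hle eps He.
    destruct (duffing_force (3 / 4 * eps) ltac:(lra)) as [T' HT'].
    exists (Rmax T T'); intros t Ht.
    assert (HTm := Rmax_l T T'); assert (HTm' := Rmax_r T T').
    specialize (HT' t ltac:(lra)); rewrite Rminus_0_r in HT'.
    specialize (Hle t ltac:(lra)); lra. }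
  assert (Habs : forall x e y, 3 / 4 <= Rabs y -> x ^ 3 - x = y * (x - e) ->
            3 / 4 * Rabs (x - e) <= Rabs (x ^ 3 - x)).
  { intros x e y Hy ->; rewrite Rabs_mult; apply Rmult_le_compat_r; [apply Rabs_pos | exact Hy]. }
  destruct (Rtotal_order (phi (T + 1)) (1 / 2)) as [Hlt|[Heq|Hgt]].
  - destruct (Rtotal_order (phi (T + 1)) (- (1 / 2))) as [Hlt'|[Heq|Hgt]].
    + right; right; apply Hlim; intros t Ht.
      assert (phi t < - (1 / 2)).
      { destruct (Rtotal_order (phi t) (- (1 / 2))) as [H|[H|H]]; [exact H | now apply Hm in H |].
        assert (- (1 / 2) < phi (T + 1)) by (apply (duffing_side _ T t); auto; lra); lra. }
      apply Habs with (phi t * (phi t - 1)); [|ring].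
      rewrite Rabs_pos_eq; nra.
    + exfalso; apply (Hm (T + 1)); lra.
    + left; apply Hlim; intros t Ht.
      assert (- (1 / 2) < phi t) by (apply (duffing_side _ T (T + 1)); auto; lra).
      assert (phi t < 1 / 2).
      { destruct (Rtotal_order (phi t) (1 / 2)) as [H'|[H'|H']]; [exact H' | now apply Hp in H' |].
        assert (1 / 2 < phi (T + 1)) by (apply (duffing_side _ T t); auto; lra); lra. }
      apply Habs with (phi t ^ 2 - 1); [|ring].
      rewrite Rabs_left; nra.
  - exfalso; apply (Hp (T + 1)); lra.
  - right; left; apply Hlim; intros t Ht.
    assert (1 / 2 < phi t) by (apply (duffing_side _ T (T + 1)); auto; lra).
    apply Habs with (phi t * (phi t + 1)); [|ring].
    rewrite Rabs_pos_eq; nra.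
Qed.

End DuffingConvergence.

(** * The stable manifold of the origin *)

Lemma sum_f_R0_le (f : nat -> R) (m : nat) (C : R) :
  (forall i, (i <= m)%nat -> Rabs (f i) <= C) -> Rabs (sum_f_R0 f m) <= INR (S m) * C.
Proof.
  intros H; induction m as [|m IH].
  - simpl; rewrite Rmult_1_l; now apply H.
  - rewrite S_INR, Rmult_plus_distr_r, Rmult_1_l; apply Rabs_plus_le.
    + apply IH; intros; apply H; lia.
    + now apply H.
Qed.

Lemma PS_mult_ext_le (a a' b b' : nat -> R) (m : nat) :
  (forall i, (i <= m)%nat -> a i = a' i) -> (forall i, (i <= m)%nat -> b i = b' i) ->
  PS_mult a b m = PS_mult a' b' m.
Proof.
  intros Ha Hb; apply sum_eq; intros i Hi; rewrite Ha, Hb; [reflexivity | lia..].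
Qed.

Lemma PS_mult_le (a b : nat -> R) (m : nat) (A B : R) :
  (forall i, (i <= m)%nat -> Rabs (a i) <= A) -> (forall i, (i <= m)%nat -> Rabs (b i) <= B) ->
  Rabs (PS_mult a b m) <= INR (S m) * (A * B).
Proof.
  intros Ha Hb; apply sum_f_R0_le; intros i Hi.
  apply Rabs_mult_le; [apply Ha | apply Hb]; lia.
Qed.

(** The solutions of [phi'' + k phi' + w (phi^3 - phi) = 0] on the stable manifold
    of [0] are sought as [phi t = F (z exp (- nu t))] with [F z = z sum b_n z^n]
    and [- nu] the negative root of [r^2 + k r - w].  Comparing the coefficients of
    [z^(n+1)] gives [chi (n+1) b_n = - w (b * b * b)_(n-2)], with [b_0 = 1]. *)
Section StableManifold.

Variables (k w : R).
Hypotheses (Hk : 0 < k) (Hw : 0 < w).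

Definition nu : R := (k + sqrt (k ^ 2 + 4 * w)) / 2.
Definition chi (n : nat) : R := nu ^ 2 * INR n ^ 2 - k * nu * INR n - w.

Definition coef_step (b : nat -> R) (n : nat) : R :=
  match n with
  | O => 1
  | 1%nat => 0
  | S (S m) => - w / chi (S n) * PS_mult b (PS_mult b b) m
  end.

Definition coef_iter (N : nat) : nat -> R := Nat.iter N coef_step (fun _ => 0).
Definition coef (n : nat) : R := coef_iter (S n) n.

Lemma coef_step_local (b b' : nat -> R) (n : nat) :
  (forall i, (i + 2 <= n)%nat -> b i = b' i) -> coef_step b n = coef_step b' n.
Proof.
  intros H; destruct n as [|[|m]]; [reflexivity..|]; simpl; f_equal.
  apply PS_mult_ext_le; [intros; apply H; lia|].
  intros i Hi; apply PS_mult_ext_le; intros; apply H; lia.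
Qed.

Lemma coef_iter_stable (n N N' : nat) :
  (n < N)%nat -> (n < N')%nat -> coef_iter N n = coef_iter N' n.
Proof.
  revert N N'; induction n as [n IH] using lt_wf_ind; intros [|N] [|N'] HN HN'; try lia.
  apply coef_step_local; intros i Hi; apply IH; lia.
Qed.

Lemma coef_fixpoint (n : nat) : coef n = coef_step coef n.
Proof.
  apply coef_step_local; intros i Hi; apply coef_iter_stable; lia.
Qed.

Lemma nu_spec : 0 < nu /\ k < nu /\ nu ^ 2 = k * nu + w.
Proof.
  assert (Hq : sqrt (k ^ 2 + 4 * w) ^ 2 = k ^ 2 + 4 * w) by (apply pow2_sqrt; nra).
  assert (Hs := sqrt_pos (k ^ 2 + 4 * w)).
  unfold nu; set (q := sqrt (k ^ 2 + 4 * w)) in *.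
  assert (k < q) by nra.
  repeat split; [lra | lra | nra].
Qed.

Lemma chi_ge (n : nat) : nu ^ 2 * (INR n * INR (S n)) <= chi (S n).
Proof.
  destruct nu_spec as [H1 [H2 H3]]; unfold chi; rewrite S_INR.
  assert (Hn := pos_INR n).
  assert (Hw' : w = nu ^ 2 - k * nu) by lra; rewrite Hw'.
  assert (0 <= (nu - k) * nu) by (apply Rmult_le_pos; lra).
  assert (0 <= (nu - k) * nu * INR n) by (apply Rmult_le_pos; lra).
  nra.
Qed.

Lemma coef_le1 (n : nat) : Rabs (coef n) <= 1.
Proof.
  induction n as [n IH] using lt_wf_ind; rewrite coef_fixpoint.
  destruct n as [|[|m]]; [simpl; rewrite Rabs_R1; lra | simpl; rewrite Rabs_R0; lra|].
  assert (Hm := pos_INR m).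
  assert (HP : Rabs (PS_mult coef (PS_mult coef coef) m) <= INR (S m) * (1 * INR (S m))).
  { apply PS_mult_le; [intros; apply IH; lia|]; intros i Hi.
    apply Rle_trans with (INR (S i) * (1 * 1)).
    - apply PS_mult_le; intros; apply IH; lia.
    - rewrite !Rmult_1_r; apply le_INR; lia. }
  destruct nu_spec as [H1 [H2 H3]].
  assert (Hc := chi_ge (S (S m))).
  rewrite !S_INR in Hc; rewrite !S_INR in HP.
  assert (Hkn : 0 < k * nu) by (apply Rmult_lt_0_compat; lra).
  assert (Hq : 0 < (INR m + 1 + 1) * (INR m + 1 + 1 + 1)) by nra.
  assert (Hc0 : 0 < chi (S (S (S m)))).
  { eapply Rlt_le_trans; [|exact Hc]; apply Rmult_lt_0_compat; [lra | exact Hq]. }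
  simpl; rewrite Rabs_mult; unfold Rdiv.
  rewrite Rabs_mult, Rabs_Ropp, Rabs_inv, (Rabs_pos_eq w), (Rabs_pos_eq (chi _)) by lra.
  apply Rmult_le_reg_l with (chi (S (S (S m)))); [exact Hc0|].
  set (X := Rabs (PS_mult coef (PS_mult coef coef) m)) in *.
  replace (chi (S (S (S m))) * (w * / chi (S (S (S m))) * X)) with (w * X) by (field; lra).
  assert (HX : X <= (INR m + 1 + 1) * (INR m + 1 + 1 + 1)) by nra.
  assert (w * X <= nu ^ 2 * ((INR m + 1 + 1) * (INR m + 1 + 1 + 1))).
  { apply Rle_trans with (w * ((INR m + 1 + 1) * (INR m + 1 + 1 + 1))).
    - apply Rmult_le_compat_l; lra.
    - apply Rmult_le_compat_r; lra. }
  lra.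
Qed.

Lemma CV_radius_gt (a : nat -> R) (x : R) :
  (forall n, Rabs (a n) <= 2 ^ n) -> Rabs x < 1 / 2 -> Rbar_lt (Rabs x) (CV_radius a).
Proof.
  intros Ha Hx; apply Rbar_lt_le_trans with (1 / 2); [exact Hx|].
  apply (proj1 (CV_radius_bounded a)); exists 1; intros n.
  rewrite Rabs_mult, (Rabs_pos_eq ((1 / 2) ^ n)) by (apply pow_le; lra).
  replace 1 with (2 ^ n * (1 / 2) ^ n) at 2
    by (rewrite <- Rpow_mult_distr; replace (2 * (1 / 2)) with 1 by field; apply pow1).
  apply Rmult_le_compat_r; [apply pow_le; lra | apply Ha].
Qed.

Definition ser : nat -> R := PS_incr_1 coef.

Lemma one_le_pow2 (n : nat) : INR (S n) <= 2 ^ n.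
Proof.
  induction n as [|n IH]; [simpl; lra|].
  assert (1 <= INR (S n)) by (rewrite S_INR; assert (H := pos_INR n); lra).
  rewrite S_INR; simpl pow.
  lra.
Qed.

Lemma ser_radius (x : R) : Rabs x < 1 / 2 -> Rbar_lt (Rabs x) (CV_radius ser).
Proof.
  intros Hx; unfold ser; rewrite CV_radius_incr_1; apply CV_radius_gt; [|exact Hx].
  intros n; eapply Rle_trans; [apply coef_le1 | apply pow_R1_Rle; lra].
Qed.

Definition stab : R -> R := PSeries ser.
Definition stab1 : R -> R := PSeries (PS_derive ser).
Definition stab2 : R -> R := PSeries (PS_derive (PS_derive ser)).

Lemma is_derive_stab (z : R) : Rabs z < 1 / 2 -> is_derive stab z (stab1 z).
Proof. intros Hz; apply is_derive_PSeries, ser_radius, Hz. Qed.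

Lemma is_derive_stab1 (z : R) : Rabs z < 1 / 2 -> is_derive stab1 z (stab2 z).
Proof.
  intros Hz; apply is_derive_PSeries; rewrite CV_radius_derive; apply ser_radius, Hz.
Qed.

Lemma continuous_stab2 (z : R) : Rabs z < 1 / 2 -> continuous stab2 z.
Proof.
  intros Hz; apply (ex_derive_continuous stab2); eexists; apply is_derive_PSeries.
  rewrite !CV_radius_derive; apply ser_radius, Hz.
Qed.

Lemma stab_0 : stab 0 = 0.
Proof. unfold stab; rewrite PSeries_0; reflexivity. Qed.

Lemma stab1_0 : stab1 0 = 1.
Proof.
  unfold stab1; rewrite PSeries_0; unfold PS_derive, ser; simpl.
  rewrite coef_fixpoint; simpl; ring.
Qed.

Lemma stab_equation (z : R) :
  Rabs z < 1 / 2 ->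
  nu ^ 2 * (z ^ 2 * stab2 z + z * stab1 z) - k * nu * (z * stab1 z) + w * (stab z ^ 3 - stab z) = 0.
Proof.
  intros Hz.
  assert (Hr := ser_radius z Hz).
  assert (Hb : Rbar_lt (Rabs z) (CV_radius coef)) by (rewrite <- CV_radius_incr_1; exact Hr).
  assert (Hbb : Rbar_lt (Rabs z) (CV_radius (PS_mult coef coef))).
  { apply CV_radius_gt; [|exact Hz]; intros n.
    eapply Rle_trans; [apply (PS_mult_le coef coef n 1 1); intros; apply coef_le1|].
    rewrite !Rmult_1_r; apply one_le_pow2. }
  set (c3 := PS_incr_1 (PS_incr_1 (PS_incr_1 (PS_mult coef (PS_mult coef coef))))).
  set (d1 := PS_incr_1 (PS_derive ser)).
  set (d2 := PS_incr_1 (PS_incr_1 (PS_derive (PS_derive ser)))).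
  assert (E0 : is_pseries ser z (stab z)) by (apply PSeries_correct, CV_radius_inside, Hr).
  assert (E1 : is_pseries d1 z (z * stab1 z)).
  { apply (is_pseries_incr_1 (PS_derive ser) z (stab1 z)), PSeries_correct, CV_radius_inside.
    now rewrite CV_radius_derive. }
  assert (E2 : is_pseries d2 z (z * (z * stab2 z))).
  { apply (is_pseries_incr_1 _ z (z * stab2 z)), (is_pseries_incr_1 _ z (stab2 z)).
    apply PSeries_correct, CV_radius_inside; now rewrite !CV_radius_derive. }
  assert (E3 : is_pseries c3 z (stab z ^ 3)).
  { replace (stab z ^ 3) with
      (z * (z * (z * (PSeries coef z * (PSeries coef z * PSeries coef z))))).
    - apply (is_pseries_incr_1 _ z (z * (z * _))), (is_pseries_incr_1 _ z (z * _)),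
        (is_pseries_incr_1 _ z (_ * _)).
      apply is_pseries_mult; try assumption.
      + apply PSeries_correct, CV_radius_inside, Hb.
      + apply is_pseries_mult; try assumption; apply PSeries_correct, CV_radius_inside, Hb.
    - unfold stab, ser; rewrite PSeries_incr_1; ring. }
  assert (Hcom : forall x y : R, mult x y = mult y x) by (intros; apply Rmult_comm).
  assert (E := is_pseries_plus _ _ _ _ _
    (is_pseries_plus _ _ _ _ _ (is_pseries_scal (nu ^ 2) _ _ _ (Hcom _ _) E2)
       (is_pseries_scal (nu ^ 2 - k * nu) _ _ _ (Hcom _ _) E1))
    (is_pseries_plus _ _ _ _ _ (is_pseries_scal w _ _ _ (Hcom _ _) E3)
       (is_pseries_scal (- w) _ _ _ (Hcom _ _) E0))).
  apply is_pseries_unique in E.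
  rewrite (PSeries_ext _ (fun _ => 0)), PSeries_const_0 in E.
  - unfold plus, scal in E; simpl in E; unfold mult in E; simpl in E.
    simpl; lra.
  - intros n.
    change (nu ^ 2 * d2 n + (nu ^ 2 - k * nu) * d1 n + (w * c3 n + - w * ser n) = 0).
    destruct nu_spec as [H1 [H2 H3]].
    destruct n as [|[|[|m]]].
    + change (nu ^ 2 * 0 + (nu ^ 2 - k * nu) * 0 + (w * 0 + - w * 0) = 0); ring.
    + change (nu ^ 2 * 0 + (nu ^ 2 - k * nu) * (1 * coef 0) + (w * 0 + - w * coef 0) = 0).
      rewrite H3; ring.
    + change (nu ^ 2 * (1 * (INR 2 * coef 1)) + (nu ^ 2 - k * nu) * (INR 2 * coef 1)
              + (w * 0 + - w * coef 1) = 0).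
      rewrite (coef_fixpoint 1); simpl; ring.
    + assert (Hc := chi_ge (S (S m))).
      assert (Hm := pos_INR m).
      assert (0 < chi (S (S (S m)))).
      { eapply Rlt_le_trans; [|exact Hc]; apply Rmult_lt_0_compat; [nra|].
        rewrite !S_INR; nra. }
      change (nu ^ 2 * (INR (S (S m)) * (INR (S (S (S m))) * coef (S (S m))))
              + (nu ^ 2 - k * nu) * (INR (S (S (S m))) * coef (S (S m)))
              + (w * PS_mult coef (PS_mult coef coef) m + - w * coef (S (S m))) = 0).
      rewrite (coef_fixpoint (S (S m))); unfold coef_step.
      set (X := PS_mult coef (PS_mult coef coef) m).
      transitivity (chi (S (S (S m))) * (- w / chi (S (S (S m))) * X) + w * X).
      * set (Y := - w / chi (S (S (S m))) * X); unfold chi; rewrite !S_INR; ring.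
      * field; lra.
Qed.
End StableManifold.

Lemma is_derive_mult_Rabs (t : R) : is_derive (fun s => s * Rabs s) t (2 * Rabs t).
Proof.
  destruct (Req_dec t 0) as [->|Ht].
  - apply is_derive_Reals; intros eps He; exists (mkposreal eps He); intros h Hh Hlt.
    replace ((_ - _) / h - _) with (Rabs h).
    + now rewrite Rabs_Rabsolu.
    + rewrite Rplus_0_l, Rabs_R0; field; exact Hh.
  - auto_derive; [easy|].
    destruct (Rtotal_order t 0) as [H|[H|H]]; [|easy|].
    + rewrite sign_eq_m1, Rabs_left by exact H; ring.
    + rewrite sign_eq_1, Rabs_right by lra; ring.
Qed.

(** [clock] is of class C^2, the identity for [t >= 0] and bounded from below; it
    replaces [t] in order to extend the solutions on [t >= 0] to C^2 functions on R. *)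
Definition clock (t : R) : R := t + t * (t * Rabs t) - t ^ 3.
Definition clock1 (t : R) : R := 1 + 3 * (t * Rabs t) - 3 * t ^ 2.
Definition clock2 (t : R) : R := 6 * Rabs t - 6 * t.

Lemma is_derive_clock (t : R) : is_derive clock t (clock1 t).
Proof.
  assert (H := is_derive_mult_Rabs t).
  unfold clock; set (f := fun s => s * Rabs s) in *.
  apply is_derive_ext with (fun t => t + t * f t - t ^ 3); [reflexivity|].
  auto_derive; [now exists (2 * Rabs t)|].
  rewrite (is_derive_unique (fun x : R => f x) _ _ H); unfold f, clock1; ring.
Qed.

Lemma is_derive_clock1 (t : R) : is_derive clock1 t (clock2 t).
Proof.
  assert (H := is_derive_mult_Rabs t).
  unfold clock1; set (f := fun s => s * Rabs s) in *.
  apply is_derive_ext with (fun t => 1 + 3 * f t - 3 * t ^ 2); [reflexivity|].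
  auto_derive; [now exists (2 * Rabs t)|].
  rewrite (is_derive_unique (fun x : R => f x) _ _ H); unfold clock2; ring.
Qed.

Lemma clock_ge0 (t : R) : 0 <= t -> clock t = t /\ clock1 t = 1 /\ clock2 t = 0.
Proof.
  intros Ht; unfold clock, clock1, clock2; rewrite Rabs_pos_eq by exact Ht.
  repeat split; ring.
Qed.

Lemma clock_ge (t : R) : - 1 <= clock t.
Proof.
  destruct (Rle_lt_dec 0 t) as [Ht|Ht]; [rewrite (proj1 (clock_ge0 t Ht)); lra|].
  unfold clock; rewrite Rabs_left by exact Ht.
  assert (0 <= - t * (t + 1) ^ 2) by (apply Rmult_le_pos; [lra | apply pow2_ge_0]).
  nra.
Qed.

Lemma exists_stable_family (k w : R) :
  0 < k -> 0 < w ->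
  exists phi phi1 phi2 : nat -> R -> R,
    (forall n, duffing k w (phi n) (phi1 n) (phi2 n) /\
       (forall t, continuous (phi2 n) t) /\ 0 < phi n 0 /\ tends_to (phi n) 0) /\
    (forall n n', n <> n' -> phi n 0 <> phi n' 0).
Proof.
  intros Hk Hw.
  set (F0 := stab k w); set (F1 := stab1 k w); set (F2 := stab2 k w); set (r := nu k w).
  destruct (nu_spec k w Hk Hw) as [Hr [_ Hr2]]; fold r in Hr, Hr2.
  assert (D0 := is_derive_stab k w Hk Hw); assert (D1 := is_derive_stab1 k w Hk Hw).
  assert (C2 := continuous_stab2 k w Hk Hw); assert (HF := stab_equation k w Hk Hw).
  fold F0 F1 F2 r in D0, D1, C2, HF.
  assert (F00 : F0 0 = 0) by apply stab_0; assert (F10 : F1 0 = 1) by apply stab1_0.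
  assert (H0 : Rabs 0 < 1 / 2) by (rewrite Rabs_R0; lra).
  assert (Cont : forall f f' : R -> R, (forall z, Rabs z < 1 / 2 -> is_derive f z (f' z)) ->
            forall eps, 0 < eps -> exists d, 0 < d < 1 / 2 /\
            forall z, Rabs z < d -> Rabs (f z - f 0) < eps).
  { intros f f' Hf eps He.
    assert (Hc : continuous f 0)
      by (apply (ex_derive_continuous f); eexists; now apply Hf).
    destruct (proj1 (filterlim_locally _ _) Hc (mkposreal eps He)) as [d Hd].
    assert (Hdp := cond_pos d).
    exists (Rmin (d / 2) (1 / 4)).
    assert (H1 := Rmin_l (d / 2) (1 / 4)); assert (H2 := Rmin_r (d / 2) (1 / 4)).
    split; [split; [apply Rmin_pos; lra | lra]|].
    intros z Hz; apply Hd; change (Rabs (z - 0) < d); rewrite Rminus_0_r; lra. }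
  destruct (Cont F1 F2 D1 1 ltac:(lra)) as [d [Hd HF1]].
  assert (Hincr : forall x y, 0 <= x < y -> y < d -> F0 x < F0 y).
  { intros x y Hxy Hy.
    destruct (MVT_gen F0 x y F1) as [z [Hz E]];
      rewrite ?Rmin_left, ?Rmax_right in * by lra.
    - intros z Hz; apply D0; rewrite Rabs_pos_eq; lra.
    - intros z Hz; apply continuity_pt_filterlim, (ex_derive_continuous F0).
      eexists; apply D0; rewrite Rabs_pos_eq; lra.
    - assert (Hz1 : Rabs (F1 z - F1 0) < 1) by (apply HF1; rewrite Rabs_pos_eq; lra).
      rewrite F10 in Hz1; apply Rabs_def2 in Hz1.
      assert (0 < F1 z * (y - x)) by (apply Rmult_lt_0_compat; lra); lra. }
  set (z := fun n => d * exp (- r) / INR (n + 2)).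
  assert (Hz : forall n, 0 < z n /\ z n * exp r < d).
  { intros n; assert (HN : 2 <= INR (n + 2))
      by (rewrite plus_INR; simpl; assert (H := pos_INR n); lra).
    assert (He := exp_pos (- r)); unfold z; split.
    - apply Rdiv_lt_0_compat; [apply Rmult_lt_0_compat|]; lra.
    - replace (d * exp (- r) / INR (n + 2) * exp r) with (d / INR (n + 2)).
      + apply Rmult_lt_reg_r with (INR (n + 2)); [lra|].
        unfold Rdiv; rewrite Rmult_assoc, Rinv_l by lra; nra.
      + rewrite exp_Ropp; field; split; [|lra]; assert (H := exp_pos r); lra. }
  set (th := fun n t => z n * exp (- r * clock t)).
  assert (Hth : forall n t, 0 < th n t < d).
  { intros n t; destruct (Hz n) as [Hz0 Hzd]; unfold th.
    assert (He := exp_pos (- r * clock t)); split; [now apply Rmult_lt_0_compat|].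
    apply Rle_lt_trans with (z n * exp r); [|exact Hzd].
    apply Rmult_le_compat_l; [lra|].
    assert (- r * clock t <= r) by (assert (Hc := clock_ge t); nra).
    destruct H as [H|H]; [left; now apply exp_increasing | right; now rewrite H]. }
  assert (Hth0 : forall n, th n 0 = z n).
  { intros n; unfold th; rewrite (proj1 (clock_ge0 0 ltac:(lra))), Rmult_0_r, exp_0; ring. }
  assert (Hth' : forall n t, Rabs (th n t) < 1 / 2).
  { intros n t; assert (H := Hth n t); rewrite Rabs_pos_eq; lra. }
  assert (Hzd : forall n, z n < d) by (intros n; rewrite <- Hth0; apply Hth).
  set (th1 := fun n t => - r * clock1 t * th n t).
  set (th2 := fun n t => (r ^ 2 * clock1 t ^ 2 - r * clock2 t) * th n t).
  assert (Dth : forall n t, is_derive (th n) t (th1 n t)).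
  { intros n t; unfold th, th1; assert (Hc := is_derive_clock t).
    auto_derive; [now exists (clock1 t)|].
    rewrite (is_derive_unique (fun x : R => clock x) _ _ Hc); unfold th; ring. }
  assert (Dth1 : forall n t, is_derive (th1 n) t (th2 n t)).
  { intros n t; assert (Hc := is_derive_clock1 t); assert (Ht := Dth n t).
    unfold th1; auto_derive; [repeat split; eexists; eassumption|].
    rewrite (is_derive_unique (fun x : R => clock1 x) _ _ Hc),
      (is_derive_unique (fun x : R => th n x) _ _ Ht); unfold th1, th2; ring. }
  exists (fun n t => F0 (th n t)), (fun n t => F1 (th n t) * th1 n t),
    (fun n t => F2 (th n t) * th1 n t ^ 2 + F1 (th n t) * th2 n t).
  split; [intros n; split; [split; [|split]|split; [|split]]|].
  - intros t; rewrite Rmult_comm.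
    apply (is_derive_comp F0 (th n) t); [now apply D0 | apply Dth].
  - intros t.
    assert (E1 : is_derive (fun t => F1 (th n t)) t (th1 n t * F2 (th n t)))
      by (apply (is_derive_comp F1 (th n) t); [now apply D1 | apply Dth]).
    assert (E2 := Dth1 n t).
    replace (F2 (th n t) * th1 n t ^ 2 + F1 (th n t) * th2 n t)
      with (th1 n t * F2 (th n t) * th1 n t + F1 (th n t) * th2 n t) by ring.
    exact (is_derive_mult (fun t => F1 (th n t)) (th1 n) t _ _ E1 E2 Rmult_comm).
  - intros t Ht; assert (E := HF (th n t) (Hth' n t)).
    destruct (clock_ge0 t ltac:(lra)) as [_ [Hc1 Hc2]].
    unfold th1, th2; rewrite Hc1, Hc2; lra.
  - intros t.
    assert (Cth : forall u, continuous (th n) u)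
      by (intros u; apply (ex_derive_continuous (th n)); eexists; apply Dth).
    assert (Cth1 : continuous (th1 n) t)
      by (apply (ex_derive_continuous (th1 n)); eexists; apply Dth1).
    assert (Cc1 : continuous clock1 t)
      by (apply (ex_derive_continuous clock1); eexists; apply is_derive_clock1).
    assert (CF1 : continuous (fun t => F1 (th n t)) t).
    { apply (continuous_comp (th n) F1); [apply Cth|].
      apply (ex_derive_continuous F1); eexists; now apply D1. }
    assert (CF2 : continuous (fun t => F2 (th n t)) t)
      by (apply (continuous_comp (th n) F2); [apply Cth | now apply C2]).
    assert (Cth2 : continuous (th2 n) t).
    { apply continuity_pt_filterlim; apply continuity_pt_filterlim in Cc1.
      assert (Ct := proj2 (continuity_pt_filterlim _ _) (Cth t)).
      unfold th2, clock2; cpt; apply Rcontinuity_abs. }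
    apply continuity_pt_filterlim; apply continuity_pt_filterlim in CF1, CF2, Cth1, Cth2.
    cpt.
  - cbv beta; rewrite Hth0, <- F00; apply Hincr; [|apply Hzd]; assert (H := Hz n); lra.
  - intros eps He; destruct (Cont F0 F1 D0 eps He) as [d' [Hd' HF0]].
    exists (z n / (d' * r)); intros t Ht; rewrite <- F00; apply HF0.
    assert (Hzn := proj1 (Hz n)).
    assert (Hdr : 0 < d' * r) by (apply Rmult_lt_0_compat; lra).
    assert (Hq : 0 < z n / (d' * r)) by (apply Rdiv_lt_0_compat; lra).
    rewrite Rabs_pos_eq by (left; apply Hth).
    unfold th; rewrite (proj1 (clock_ge0 t ltac:(lra))).
    replace (- r * t) with (- (r * t)) by ring; rewrite exp_Ropp.
    assert (Hexp := exp_ineq1_le (r * t)); assert (Hep := exp_pos (r * t)).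
    apply Rmult_lt_reg_r with (exp (r * t)); [exact Hep|].
    rewrite Rmult_assoc, Rinv_l, Rmult_1_r by lra.
    assert (Hzt : z n < d' * (r * t)).
    { replace (z n) with (d' * r * (z n / (d' * r))) by (field; lra).
      rewrite <- Rmult_assoc; now apply Rmult_lt_compat_l. }
    apply Rlt_le_trans with (d' * (r * t)); [exact Hzt|].
    apply Rmult_le_compat_l; lra.
  - intros n n' Hn; cbv beta; rewrite !Hth0.
    assert (Hlt : forall i j, (i < j)%nat -> F0 (z j) < F0 (z i)).
    { intros i j Hij; apply Hincr; [|apply Hzd]; split; [left; apply Hz|].
      unfold z; apply Rmult_lt_compat_l; [apply Rmult_lt_0_compat; [lra | apply exp_pos]|].
      apply Rinv_lt_contravar; [apply Rmult_lt_0_compat; apply lt_0_INR; lia|].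
      apply lt_INR; lia. }
    destruct (Nat.lt_total n n') as [H|[H|H]]; [|easy|]; apply Hlt in H; lra.
Qed.

(** * The theorem *)

Lemma zeros_in_x_tensor (l : R) (j : nat) (psi : R -> R) :
  (1 <= j)%nat -> (exists y, - l < y < l /\ psi y <> 0) ->
  zeros_in_x l (j - 1) (tensor psi (sinm (INR j))).
Proof.
  intros Hj [y0 [Hy0 Hne]].
  assert (HJ : 0 < INR j) by (apply lt_0_INR; lia).
  assert (Hpi := PI_RGT_0).
  exists (map (fun i => INR i * PI / INR j) (seq 1 (j - 1))).
  split; [|split; [now rewrite length_map, length_seq|]].
  - apply FinFun.Injective_map_NoDup; [|apply seq_NoDup].
    intros a b Hab; apply INR_eq.
    apply Rmult_eq_reg_r with (PI / INR j); [unfold Rdiv in *; lra|].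
    apply Rgt_not_eq, Rdiv_lt_0_compat; lra.
  - intros x; rewrite in_map_iff; split.
    + intros [i [<- Hi]]; apply in_seq in Hi.
      assert (Hi1 : 1 <= INR i) by (change 1 with (INR 1); apply le_INR; lia).
      assert (Hi2 : INR i < INR j) by (apply lt_INR; lia).
      assert (Hx : INR j * (INR i * PI / INR j) = INR i * PI) by (field; lra).
      split; [split|].
      * apply Rdiv_lt_0_compat; [nra | exact HJ].
      * apply Rmult_lt_reg_l with (INR j); [exact HJ|]; rewrite Hx; nra.
      * intros y _; unfold tensor; rewrite sinm_eq, Hx, sin_eq_0_1; [ring|].
        exists (Z.of_nat i); now rewrite <- INR_IZR_INZ.
    + intros [Hx H]; specialize (H y0 Hy0); unfold tensor in H; rewrite sinm_eq in H.
      apply Rmult_integral in H as [H|H]; [contradiction|].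
      apply sin_eq_0_0 in H as [i Hi].
      assert (Hi0 : (0 < i)%Z) by (apply lt_IZR; nra).
      assert (Hij : (i < Z.of_nat j)%Z) by (apply lt_IZR; rewrite <- INR_IZR_INZ; nra).
      exists (Z.to_nat i); split; [|apply in_seq; lia].
      rewrite INR_IZR_INZ, Z2Nat.id by lia; rewrite <- Hi; field; lra.
Qed.

Lemma tensor_distinct_lt (l : R) (i j : nat) (g h : R -> R) :
  (1 <= i < j)%nat -> (exists y, - l < y < l /\ g y <> 0) ->
  exists x y, Omega l x y /\ tensor g (sinm (INR i)) x y <> tensor h (sinm (INR j)) x y.
Proof.
  intros Hij [y [Hy Hne]].
  assert (Hi : 1 <= INR i) by (change 1 with (INR 1); apply le_INR; lia).
  assert (Hlt : INR i < INR j) by (apply lt_INR; lia).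
  assert (Hpi := PI_RGT_0).
  set (x := PI / INR j).
  assert (Hx : INR j * x = PI) by (unfold x; field; lra).
  assert (Hx0 : 0 < x) by (unfold x; apply Rdiv_lt_0_compat; lra).
  exists x, y; split; [split; [split; [exact Hx0 | nra] | exact Hy]|].
  unfold tensor; rewrite !sinm_eq, Hx, sin_PI, Rmult_0_r.
  assert (0 < sin (INR i * x)) by (apply sin_gt_0; nra).
  apply Rmult_integral_contrapositive_currified; lra.
Qed.

Lemma exists_profiles (l sigma P S : R) (m : nat) :
  0 < l -> 0 < sigma < 1 -> 0 < S ->
  exists beta0, 0 < beta0 /\ forall beta, beta0 < beta ->
  exists (N : nat -> R) (psi : nat -> R -> R),
    forall j, (1 <= j <= m)%nat -> profile l sigma P S beta (INR j) (N j) (psi j).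
Proof.
  intros Hl Hs HS; induction m as [|m [b1 [Hb1 IH]]].
  - exists 1; split; [lra|]; intros beta _; exists (fun _ => 0), (fun _ _ => 0); lia.
  - destruct (exists_profile l sigma P S (INR (Datatypes.S m))) as [b2 [Hb2 H]];
      try assumption; [apply lt_0_INR; lia|].
    assert (Hmax1 := Rmax_l b1 b2); assert (Hmax2 := Rmax_r b1 b2).
    exists (Rmax b1 b2); split; [lra|]; intros beta Hbeta.
    destruct (IH beta ltac:(lra)) as [N [psi Hpsi]].
    destruct (H beta ltac:(lra)) as [N' [psi' Hpsi']].
    exists (fun j => if Nat.eqb j (Datatypes.S m) then N' else N j),
      (fun j => if Nat.eqb j (Datatypes.S m) then psi' else psi j).
    intros j Hj; destruct (Nat.eqb_spec j (Datatypes.S m)) as [->|Hne]; [exact Hpsi'|].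
    apply Hpsi; lia.
Qed.

Lemma tends_to_const (c : R) : tends_to (fun _ => c) c.
Proof. intros eps He; exists 0; intros t _; now rewrite Rminus_diag, Rabs_R0. Qed.

Theorem theorem3p6 :
  forall l sigma P S k : R,
    0 < l -> 0 < sigma < 1 -> 0 < S -> 0 < k ->
    forall m : nat, (1 <= m)%nat ->
    exists alpha_m : R, alpha_m < 0 /\
    forall alpha : R, alpha < alpha_m ->
    exists U : nat -> R -> R -> R,
      (unimodal_ST l sigma P S alpha m (U m) /\ zeros_in_x l (m - 1) (U m)) /\
      ((forall j : nat, (1 <= j <= m)%nat ->
          unimodal_ST l sigma P S alpha j (U j) /\ zeros_in_x l (j - 1) (U j)) /\
       (forall i j : nat, (1 <= i <= m)%nat -> (1 <= j <= m)%nat -> i <> j ->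
          exists x y, Omega l x y /\ U i x y <> U j x y)) /\
      ((exists phi : nat -> R -> R,
          (forall n : nat, exists u0 v0 : R -> R -> R,
             unimodal_PL l sigma P S alpha k m u0 v0
               (fun t x y => phi n t * U m x y)) /\
          (forall n n' : nat, n <> n' ->
             exists t x y, 0 <= t /\ Omega l x y /\
               phi n t * U m x y <> phi n' t * U m x y)) /\
       (forall (phi : R -> R) (u0 v0 : R -> R -> R),
          unimodal_PL l sigma P S alpha k m u0 v0
            (fun t x y => phi t * U m x y) ->
          cvg_H2 l (fun t x y => phi t * U m x y) (fun _ _ => 0) \/
          cvg_H2 l (fun t x y => phi t * U m x y) (U m) \/
          cvg_H2 l (fun t x y => phi t * U m x y) (fun x y => - U m x y)) /\
       (forall L : R -> R -> R,
          L = (fun _ _ => 0) \/ L = U m \/ L = (fun x y => - U m x y) ->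
          exists (u0 v0 : R -> R -> R) (phi : R -> R),
            unimodal_PL l sigma P S alpha k m u0 v0
              (fun t x y => phi t * U m x y) /\
            cvg_H2 l (fun t x y => phi t * U m x y) L)).
Proof.
  intros l sigma P S k Hl Hs HS Hk m Hm.
  destruct (exists_profiles l sigma P S m) as [beta0 [Hb0 H]]; try assumption.
  exists (- beta0); split; [lra|]; intros alpha Halpha.
  destruct (H (- alpha) ltac:(lra)) as [N [psi Hpsi]]; clear H.
  assert (HST : forall j, (1 <= j <= m)%nat ->
    unimodal_ST l sigma P S alpha j (tensor (psi j) (sinm (INR j))) /\
    zeros_in_x l (j - 1) (tensor (psi j) (sinm (INR j)))).
  { intros j Hj; specialize (Hpsi j Hj); split.
    - rewrite <- (Ropp_involutive alpha).
      apply (unimodal_ST_profile _ _ _ _ _ (N j)); [lia | exact Hpsi].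
    - apply zeros_in_x_tensor; [lia | apply Hpsi]. }
  exists (fun j => tensor (psi j) (sinm (INR j))); cbv beta.
  assert (Hprof := Hpsi m ltac:(lia)).
  set (U := tensor (psi m) (sinm (INR m))).
  set (w := INR m ^ 2 * S * N m).
  assert (Hw : 0 < w).
  { assert (0 < INR m) by (apply lt_0_INR; lia).
    apply Rmult_lt_0_compat; [|apply Hprof].
    apply Rmult_lt_0_compat; [now apply pow_lt | exact HS]. }
  assert (HPL : forall phi phi1 phi2, duffing k w phi phi1 phi2 ->
    (forall t, continuous phi2 t) -> phi 0 <> 0 ->
    unimodal_PL l sigma P S alpha k m (fun x y => phi 0 * U x y) (fun x y => phi1 0 * U x y)
      (fun t x y => phi t * U x y)).
  { intros phi phi1 phi2 Hd Hc Hne; rewrite <- (Ropp_involutive alpha).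
    apply (unimodal_PL_duffing _ _ _ _ _ _ (N m) _ _ _ phi1 phi2); try assumption.
    exists 0; split; [lra | exact Hne]. }
  assert (Hcvg : forall phi c, tends_to phi c ->
    cvg_H2 l (fun t x y => phi t * U x y) (fun x y => c * U x y))
    by (intros; apply cvg_H2_tensor; auto using smooth_wave; [apply Hprof | apply smooth_wave]).
  assert (E0 : (fun x y => 0 * U x y) = (fun _ _ => 0))
    by (repeat (apply functional_extensionality; intros ?); ring).
  assert (E1 : (fun x y => 1 * U x y) = U)
    by (repeat (apply functional_extensionality; intros ?); ring).
  assert (Em1 : (fun x y => - 1 * U x y) = (fun x y => - U x y))
    by (repeat (apply functional_extensionality; intros ?); ring).
  destruct (exists_stable_family k w Hk Hw) as [phi [phi1 [phi2 [Hphi Hdist]]]].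
  split; [apply HST; lia|]; split; [split; [exact HST|]|].
  - intros i j Hi Hj Hij; destruct (Nat.lt_total i j) as [Hlt|[Heq|Hlt]]; [|easy|].
    + apply tensor_distinct_lt; [lia | apply (Hpsi i Hi)].
    + destruct (tensor_distinct_lt l j i (psi j) (psi i)) as [x [y [Hin Hne]]];
        [lia | apply (Hpsi j Hj)|].
      exists x, y; split; [exact Hin | now apply not_eq_sym].
  - split; [|split].
    + exists phi; split.
      * intros n; destruct (Hphi n) as [Hd [Hc [Hpos _]]].
        eexists; eexists; apply (HPL (phi n) (phi1 n) (phi2 n)); auto; lra.
      * intros n n' Hn; destruct (profile_neq0 _ _ _ _ _ _ _ _ Hm Hprof) as [x [y [Hin Hne]]].
        exists 0, x, y; split; [lra|]; split; [exact Hin|].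
        intros E; apply Rmult_eq_reg_r in E; [|exact Hne]; now apply (Hdist n n').
    + intros f u0 v0 [_ [Hf _]].
      rewrite <- (Ropp_involutive alpha) in Hf.
      assert (Hd := duffing_of_solves_PL _ _ _ _ _ _ _ _ _ _ _ _ Hm Hprof Hf).
      destruct (duffing_limit k w _ _ _ Hk Hw Hd) as [Hlim|[Hlim|Hlim]]; apply Hcvg in Hlim.
      * left; now rewrite <- E0.
      * right; left; rewrite E1 in Hlim; exact Hlim.
      * right; right; now rewrite <- Em1.
    + assert (Hconst : forall c, c <> 0 -> c ^ 3 - c = 0 ->
        exists u0 v0 f, unimodal_PL l sigma P S alpha k m u0 v0 (fun t x y => f t * U x y) /\
          cvg_H2 l (fun t x y => f t * U x y) (fun x y => c * U x y)).
      { intros c Hc Hc3.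
        eexists; eexists; exists (fun _ => c); split; [|apply Hcvg, tends_to_const].
        apply (HPL (fun _ => c) (fun _ => 0) (fun _ => 0));
          [|intros; apply continuous_const | exact Hc].
        split; [intros; apply (is_derive_const c)|].
        split; [intros; apply (is_derive_const 0)|].
        intros; rewrite Hc3; ring. }
      intros L [->|[->| ->]].
      * destruct (Hphi 0%nat) as [Hd [Hc [Hpos Hlim]]].
        eexists; eexists; exists (phi 0%nat); split.
        -- apply (HPL (phi 0%nat) (phi1 0%nat) (phi2 0%nat)); auto; lra.
        -- rewrite <- E0; now apply Hcvg.
      * assert (H := Hconst 1 ltac:(lra) ltac:(lra)); rewrite E1 in H; exact H.
      * assert (H := Hconst (- 1) ltac:(lra) ltac:(lra)); rewrite Em1 in H; exact H.
Qed.
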